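(* Let $k\geq 3$ and let $G=G_k$ be the graph with vertex set $\{x_1,\dots,x_k,y_1,\dots,y_k\}$ and edge set $$E(G)=\{\{x_2,y_i\}:1\leq i\leq k,\ i\neq 2\}\cup\{\{x_j,y_2\}:1\leq j\leq k,\ j\neq 2\}\cup\{\{x_m,y_m\}:1\leq m\leq k,\ m\neq 2\}$$ (the Levi graph of a Hirzebruch quasi-pencil of $k$ lines in $\mathbb{P}^2_{\mathbb{C}}$). Let $S$ be the polynomial ring over a field $\mathbb{K}$ in variables $a_v,b_v$ ($v\in V(G)$) and $J_G$ the binomial edge ideal of $G$. Then $S/J_G$ is not Cohen–Macaulay. Moreover, if $k=3$ then $\dim(S/J_G)-\operatorname{depth}(S/J_G)=1$, and if $k\geq 4$ then $\dim(S/J_G)-\operatorname{depth}(S/J_G)\geq k-3$.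
   Context: For a graph $G$ with vertices labelled $1,\dots,n$, the binomial edge ideal $J_G\subseteq \mathbb{K}[a_1,\dots,a_n,b_1,\dots,b_n]$ is generated by $a_ib_j-a_jb_i$ for all edges $\{i,j\}$ with $i<j$. The quantity $\dim(S/J_G)-\operatorname{depth}(S/J_G)$ is called the Cohen–Macaulay defect. *)

(* Defs.v *)
From HB Require Import structures.
From mathcomp Require Import all_boot all_order all_algebra.
From mathcomp Require Import mpoly.
Set Implicit Arguments. Unset Strict Implicit. Unset Printing Implicit Defensive.
Import GRing.Theory.
Local Open Scope ring_scope.

Definition in_ideal (R : comNzRingType) (gs : seq R) (f : R) : Prop :=
  exists cs : seq R, f = \sum_(i < size gs) cs`_i * gs`_i.

Definition is_ideal (R : comNzRingType) (P : R -> Prop) : Prop :=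
  P 0 /\ (forall a b, P a -> P b -> P (a + b)) /\ (forall r a, P a -> P (r * a)).

Definition prime_ideal (R : comNzRingType) (P : R -> Prop) : Prop :=
  is_ideal P /\ ~ P 1 /\ (forall a b, P (a * b) -> P a \/ P b).

(* there is a chain P_0 ⊊ P_1 ⊊ ... ⊊ P_d of prime ideals of R containing
   the ideal generated by gs, i.e. a chain of primes of length d in R/(gs) *)
Definition krull_dim_ge (R : comNzRingType) (gs : seq R) (d : nat) : Prop :=
  exists C : nat -> (R -> Prop),
    (forall i, (i <= d)%N -> prime_ideal (C i) /\ (forall f, in_ideal gs f -> C i f)) /\
    (forall i, (i < d)%N ->
       (forall f, C i f -> C i.+1 f) /\ (exists f, C i.+1 f /\ ~ C i f)).

Definition krull_dim_quot (R : comNzRingType) (gs : seq R) (d : nat) : Prop :=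
  krull_dim_ge gs d /\ ~ krull_dim_ge gs d.+1.

Definition regular_seq_in (R : comNzRingType) (ms gs fs : seq R) : Prop :=
  (forall f, f \in fs -> in_ideal ms f) /\
  (forall i, (i < size fs)%N -> forall g,
       in_ideal (gs ++ take i fs) (fs`_i * g) -> in_ideal (gs ++ take i fs) g) /\
  ~ in_ideal (gs ++ fs) 1.

Definition depth_ge (R : comNzRingType) (ms gs : seq R) (d : nat) : Prop :=
  exists fs : seq R, size fs = d /\ regular_seq_in ms gs fs.

Definition depth_quot (R : comNzRingType) (ms gs : seq R) (d : nat) : Prop :=
  depth_ge ms gs d /\ ~ depth_ge ms gs d.+1.

Definition var_a (K : fieldType) (n : nat) (v : 'I_n) : {mpoly K[n + n]} :=
  'X_(lshift n v).
Definition var_b (K : fieldType) (n : nat) (v : 'I_n) : {mpoly K[n + n]} :=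
  'X_(rshift n v).

Definition BEI_gens (K : fieldType) (n : nat) (E : rel 'I_n) : seq {mpoly K[n + n]} :=
  [seq var_a K p.1 * var_b K p.2 - var_a K p.2 * var_b K p.1
  | p <- enum [pred p : 'I_n * 'I_n | E p.1 p.2 && (p.1 < p.2)%N]].

Definition all_vars (K : fieldType) (n : nat) : seq {mpoly K[n + n]} :=
  [seq var_a K v | v <- enum 'I_n] ++ [seq var_b K v | v <- enum 'I_n].

Definition BEI_CM (K : fieldType) (n : nat) (E : rel 'I_n) : Prop :=
  exists d, krull_dim_quot (BEI_gens K E) d /\ depth_quot (all_vars K n) (BEI_gens K E) d.

(* Vertices 'I_(k+k): x_i (1<=i<=k) is index i-1, y_i is index k+i-1.
   With 0-based indices p, q for x_{p+1}, y_{q+1}: x_{p+1} ~ y_{q+1} iff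
   (p = 1 and q <> 1) or (q = 1 and p <> 1) or (p = q and p <> 1). *)
Definition adjXY (p q : nat) : bool :=
  [|| (p == 1) && (q != 1), (q == 1) && (p != 1) | (p == q) && (p != 1)]%N.

Definition Gk_edge (k : nat) : rel 'I_(k + k) :=
  fun u v =>
    [|| ((u < k) && (k <= v) && adjXY u (v - k))%N
      | ((v < k) && (k <= u) && adjXY v (u - k))%N].
Arguments Gk_edge : clear implicits.

(* Main.v *)
(* The vertices v with their pairs (a_v, b_v) of variables form a theta graph:
   k - 1 paths x_2 - y_m - x_m - y_2 of length 3 between the hubs x_2 and y_2.

   Depth.  If f_1, ..., f_r is a regular sequence on S/J and F(f) H lies in J for
   a nonzero polynomial F over the field, then peeling off one variable of F at a
   time shows that H lies in J + (f_1^N, ..., f_r^N) for every N.  Localising at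
   the component of the variety where the vectors at x_1 and x_2 vanish, every
   variable becomes a rational function of 2k of them, so counting monomials
   shows that any 2k + 1 elements satisfy such a relation, with H nonzero at the
   generic point of a line in that component.  Hence depth <= 2k.

   Dimension.  Deleting the two hubs leaves k - 1 edges, whose parametrisation
   gives a chain of primes of length 3(k - 1) >= 2k + 1 when k >= 4.  For k = 3 the
   graph is a hexagon; the generic component gives a chain of length 7, and 7 is
   an upper bound because a Hamiltonian path already forces every prime over J to
   have a residue field generated by at most 7 variables: elements of
   P_(i+1) \ P_i taken along a chain are algebraically independent modulo P_0.

   Depth of the hexagon.  Write J = Q + (g) where Q is the ideal of the path
   0 - 1 - ... - 5 and g the minor of the edge 0 - 5.  The six forms
   z_i = a_i - b_(i+1), indices mod 6, and w = b_0 form a regular sequence on S/Q,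
   and Q : g = Q + (m_0, ..., m_4) with m_t = b_1 ... b_t a_(t+1) ... a_4.  Modulo
   the z_i this is a statement on the monoid ring with c_i^2 = c_(i-1) c_(i+1):
   (c_1 c_5)^3 is a multiple of w^2 m_2 there while g = c_1 c_5 - w^2, so g f = 0
   gives w^6 f = 0 modulo the m_t, and w is regular modulo them.  The description
   of the colon ideal lifts along the z_i, which are therefore regular on S/J. *)
Require Import Defs.
From HB Require Import structures.
From mathcomp Require Import all_boot all_order all_algebra.
From mathcomp Require Import mpoly ring zify.
From Stdlib Require Import Classical_Prop.
Set Implicit Arguments. Unset Strict Implicit. Unset Printing Implicit Defensive.
Import GRing.Theory.
Local Open Scope ring_scope.

(** * Ideals and regular sequences *)

Section Ideals.
Variable R : comNzRingType.
Implicit Types (I : R -> Prop) (gs fs : seq R) (x y z f g : R).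

Lemma is_idealB I x y : is_ideal I -> I x -> I y -> I (x - y).
Proof. by case=> _ [iD iM] Ix Iy; apply: (iD) => //; rewrite -mulN1r; apply: iM. Qed.

Lemma is_idealN I x : is_ideal I -> I x -> I (- x).
Proof. by case=> _ [_ iM] Ix; rewrite -mulN1r; apply: iM. Qed.

Lemma is_ideal_sum I (J : Type) (r : seq J) (P : pred J) (F : J -> R) :
  is_ideal I -> (forall i, P i -> I (F i)) -> I (\sum_(i <- r | P i) F i).
Proof. by case=> i0 [iD _] IF; elim/big_rec: _ => // i x Pi Ix; apply: iD => //; apply: IF. Qed.

Lemma in_ideal_nil f : in_ideal [::] f <-> f = 0.
Proof.
split=> [[cs ->]|->]; first by rewrite big_ord0.
by exists [::]; rewrite big_ord0.
Qed.

Lemma in_ideal_cons g gs f : in_ideal (g :: gs) f <-> exists r, in_ideal gs (f - r * g).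
Proof.
split=> [[cs ->]|[r [cs E]]].
  exists cs`_0, (behead cs).
  rewrite [size _]/= big_ord_recl /= addrAC subrr add0r.
  by apply: eq_bigr => i _; rewrite nth_behead.
by exists (r :: cs); rewrite [size _]/= big_ord_recl /= -E addrC subrK.
Qed.

Lemma in_ideal_is_ideal gs : is_ideal (in_ideal gs).
Proof.
rewrite /is_ideal; elim: gs => [|g gs [i0 [iD iM]]].
  split; first exact/in_ideal_nil.
  split=> [a b|r a]; rewrite !in_ideal_nil; first by move=> -> ->; rewrite addr0.
  by move=> ->; rewrite mulr0.
split; first by apply/in_ideal_cons; exists 0; rewrite mul0r subr0.
split=> [a b|r a]; rewrite !in_ideal_cons.
- by case=> s ias [t ibt]; exists (s + t); rewrite mulrDl opprD addrACA; apply: iD.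
- by case=> s ias; exists (r * s); rewrite -mulrA -mulrBr; apply: iM.
Qed.

Lemma in_ideal0 gs : in_ideal gs 0.
Proof. by case: (in_ideal_is_ideal gs). Qed.
Lemma in_idealD gs x y : in_ideal gs x -> in_ideal gs y -> in_ideal gs (x + y).
Proof. by case: (in_ideal_is_ideal gs) => _ []; auto. Qed.
Lemma in_idealMl gs x y : in_ideal gs y -> in_ideal gs (x * y).
Proof. by case: (in_ideal_is_ideal gs) => _ []; auto. Qed.
Lemma in_idealMr gs x y : in_ideal gs x -> in_ideal gs (x * y).
Proof. by rewrite mulrC; apply: in_idealMl. Qed.
Lemma in_idealN gs x : in_ideal gs x -> in_ideal gs (- x).
Proof. exact: is_idealN (in_ideal_is_ideal gs). Qed.
Lemma in_idealB gs x y : in_ideal gs x -> in_ideal gs y -> in_ideal gs (x - y).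
Proof. exact: is_idealB (in_ideal_is_ideal gs). Qed.
Lemma in_idealBr gs x y : in_ideal gs (x - y) -> in_ideal gs x <-> in_ideal gs y.
Proof.
move=> xy; split=> ?; last by rewrite -(subrK y x); apply: in_idealD.
by rewrite -(subKr x y); apply: in_idealB.
Qed.

Lemma in_ideal_gen gs g : g \in gs -> in_ideal gs g.
Proof.
elim: gs => // h gs IH; rewrite inE in_ideal_cons => /orP[/eqP->|/IH ?].
  by exists 1; rewrite mul1r subrr; apply: in_ideal0.
by exists 0; rewrite mul0r subr0.
Qed.

Lemma in_ideal_min I gs : is_ideal I -> (forall g, g \in gs -> I g) ->
  forall f, in_ideal gs f -> I f.
Proof.
move=> [i0 [iD iM]]; elim: gs => [_ f /in_ideal_nil -> //|g gs IH Igs f].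
rewrite in_ideal_cons => -[r /IH Ifr]; rewrite -(subrK (r * g) f); apply: iD.
  by apply: Ifr => h hgs; apply: Igs; rewrite inE hgs orbT.
by apply: iM; apply: Igs; rewrite inE eqxx.
Qed.

Lemma in_ideal_sub gs fs : (forall g, g \in gs -> in_ideal fs g) ->
  forall f, in_ideal gs f -> in_ideal fs f.
Proof. by apply: in_ideal_min; apply: in_ideal_is_ideal. Qed.

Lemma in_ideal_subset gs fs f : {subset gs <= fs} -> in_ideal gs f -> in_ideal fs f.
Proof. by move=> sub; apply: in_ideal_sub => g /sub; apply: in_ideal_gen. Qed.

Lemma in_ideal_consW g gs f : in_ideal gs f -> in_ideal (g :: gs) f.
Proof. by apply: in_ideal_subset => x; rewrite inE orbC => ->. Qed.

Definition same_ideal gs fs := forall f, in_ideal gs f <-> in_ideal fs f.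

Lemma same_ideal_sym gs fs : same_ideal gs fs -> same_ideal fs gs.
Proof. by move=> s f; split=> /s. Qed.
Lemma same_ideal_mem gs fs : gs =i fs -> same_ideal gs fs.
Proof. by move=> e f; split; apply: in_ideal_subset => x; rewrite e. Qed.
Lemma same_ideal_gens gs fs : (forall g, g \in gs -> in_ideal fs g) ->
  (forall f, f \in fs -> in_ideal gs f) -> same_ideal gs fs.
Proof. by move=> s1 s2 f; split; apply: in_ideal_sub. Qed.
Lemma same_ideal_cons g gs fs : same_ideal gs fs -> same_ideal (g :: gs) (g :: fs).
Proof. by move=> s f; rewrite !in_ideal_cons; split=> -[r /s]; exists r. Qed.

(** Only nonzerodivisors modulo the ideal: the unit ideal is allowed here, and properness is checked
    apart, once for a whole sequence. *)
Definition regular gs f := forall g, in_ideal gs (f * g) -> in_ideal gs g.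

Fixpoint regular_seq gs fs : Prop :=
  if fs is f :: fs' then regular gs f /\ regular_seq (f :: gs) fs' else True.

Lemma eq_regular gs gs' f : same_ideal gs gs' -> regular gs f -> regular gs' f.
Proof. by move=> s r g /s /r /s. Qed.

Lemma eq_regular_seq gs gs' fs : same_ideal gs gs' -> regular_seq gs fs -> regular_seq gs' fs.
Proof.
elim: fs gs gs' => //= f fs IH gs gs' s [rf rfs]; split; first exact: eq_regular rf.
by apply: IH rfs; apply: same_ideal_cons.
Qed.

Lemma regular_seq_rcons gs fs f :
  regular_seq gs (rcons fs f) <-> regular_seq gs fs /\ regular (rev fs ++ gs) f.
Proof.
elim: fs gs => [|g fs IH] gs /=; first by split=> [[]|[]].
by rewrite IH rev_cons cat_rcons; split=> [[? []]|[[]]].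
Qed.

Lemma regular_seq_catl gs fs fs' : regular_seq gs (fs ++ fs') -> regular_seq gs fs.
Proof.
by elim: fs gs => //= f fs IH gs [rf /IH].
Qed.

(** From x h = r y modulo [gs], regularity of y modulo x gives r = s x, and then x cancels in x (h -
    s y). *)
Lemma regular_swap gs x y : regular gs x -> regular (x :: gs) y -> regular (y :: gs) x.
Proof.
move=> rx ry h /in_ideal_cons[r hr].
have /ry/in_ideal_cons[s hs] : in_ideal (x :: gs) (y * r).
  apply/in_ideal_cons; exists h; rewrite -opprB; apply: in_idealN.
  by rewrite [h * x]mulrC [y * r]mulrC.
apply/in_ideal_cons; exists s; apply: rx.
have -> : x * (h - s * y) = (x * h - r * y) + (r - s * x) * y by ring.
by apply: in_idealD => //; apply: in_idealMr.
Qed.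

(* Exactness of 0 -> R/(gs) -a-> R/(hs) -> R/(a, hs) -> 0 is preserved by
   reduction modulo an element that is regular on R/(a, hs). *)
Lemma regular_seq_exact a gs hs fs :
  (forall y, in_ideal hs (a * y) <-> in_ideal gs y) ->
  regular_seq (a :: hs) fs -> regular_seq gs fs -> regular_seq hs fs.
Proof.
elim: fs gs hs => //= f fs IH gs hs ex [raf rafs] [rf rfs]; split.
  move=> y hfy; have /raf/in_ideal_cons[d hd] : in_ideal (a :: hs) (f * y).
    exact: in_ideal_consW.
  rewrite -(subrK (d * a) y); apply: in_idealD => //.
  rewrite mulrC; apply/ex; apply: rf; apply/ex.
  have -> : a * (f * d) = f * y - f * (y - d * a) by ring.
  by apply: in_idealB => //; apply: in_idealMl.
apply: IH rfs; last first.
  by apply: eq_regular_seq rafs; apply: same_ideal_mem => x; rewrite !inE orbCA.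
move=> y; rewrite !in_ideal_cons; split=> -[c hc]; last first.
  by exists (a * c); rewrite -mulrA -mulrBr; apply/ex.
have /raf/in_ideal_cons[d hd] : in_ideal (a :: hs) (f * c).
  apply/in_ideal_cons; exists y.
  by rewrite -opprB [y * a]mulrC [f * c]mulrC; apply: in_idealN.
exists d; apply/ex.
have -> : a * (y - d * f) = (a * y - c * f) + (c - d * a) * f by ring.
by apply: in_idealD => //; apply: in_idealMr.
Qed.

(** Induction on the exponent along 0 -> R/(a^(N+1)) -a-> R/(a^(N+2)) -> R/(a) -> 0, all modulo
    [gs], the sequence being regular on both ends. *)
Lemma regular_seq_exp gs a fs N : regular gs a -> regular_seq (a :: gs) fs ->
  regular_seq (a ^+ N.+1 :: gs) fs.
Proof.
move=> ra rafs; elim: N => [|N IH]; first by rewrite expr1.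
apply: (@regular_seq_exact a (a ^+ N.+1 :: gs)) => // [y|]; last first.
  apply: eq_regular_seq rafs; apply: same_ideal_gens => h; rewrite !inE.
    by move=> h_in; apply: in_ideal_gen; rewrite !inE; case/orP: h_in => ->; rewrite ?orbT.
  case/or3P=> [/eqP->|/eqP->|hgs]; first by apply: in_ideal_gen; rewrite inE eqxx.
    by rewrite exprS; apply: in_idealMr; apply: in_ideal_gen; rewrite inE eqxx.
  by apply: in_ideal_gen; rewrite inE hgs orbT.
rewrite !in_ideal_cons; split=> -[r hr]; exists r.
  by apply: ra; rewrite mulrBr mulrCA -exprS.
by rewrite exprS mulrCA -mulrBr; apply: in_idealMl.
Qed.

Lemma is_ideal_expD I x y M N : is_ideal I -> I (x ^+ M) -> I (y ^+ N) ->
  I ((x + y) ^+ (M + N)).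
Proof.
move=> idI Ix Iy; rewrite exprDn; have [_ [_ iM]] := idI.
apply: is_ideal_sum => // i _; rewrite -mulr_natl; apply: (iM).
have [leN|ltN] := leqP N i.
  by rewrite -(subnK leN) exprD mulrA; apply: (iM).
rewrite mulrC -(@subnK M (M + N - i)%N) ?exprD ?mulrA; first exact: (iM).
by rewrite leq_subRL ?(leq_trans (ltnW ltN)) ?leq_addl // addnC leq_add2l ltnW.
Qed.

Lemma in_ideal_colon gs ms g f : (forall u, u \in ms -> in_ideal gs (g * u)) ->
  in_ideal (ms ++ gs) f -> in_ideal gs (g * f).
Proof.
move=> gms; apply: (in_ideal_min (I := fun h => in_ideal gs (g * h))) => [|u].
  split; first by rewrite mulr0; apply: in_ideal0.
  split=> [u v gu gv|u v gv]; first by rewrite mulrDr; apply: in_idealD.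
  by rewrite mulrCA; apply: in_idealMl.
by rewrite mem_cat => /orP[/gms//|/in_ideal_gen ?]; apply: in_idealMl.
Qed.

End Ideals.

(** * Algebraic dependence *)

Lemma mpoly_alg_ind (K : fieldType) (m : nat) (P : {mpoly K[m]} -> Prop) :
  (forall c, P c%:MP) -> (forall i, P 'X_i) ->
  (forall f g, P f -> P g -> P (f + g)) -> (forall f g, P f -> P g -> P (f * g)) ->
  forall f, P f.
Proof.
move=> PC PX PD PM; elim/mpolyind => [|c e p _ _ IH]; first by rewrite -mpolyC0.
apply: (PD) => //; rewrite -mul_mpolyC; apply: (PM) => //.
rewrite mpolyXE_id; elim/big_rec: _ => [|i x _ Px]; first by rewrite -mpolyC1.
apply: (PM) => //; elim: (e i) => [|k IHk]; first by rewrite expr0 -mpolyC1.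
by rewrite exprS; apply: (PM).
Qed.

Lemma mpolyX_neq0 (K : fieldType) (m : nat) (i : 'I_m) : 'X_i != 0 :> {mpoly K[m]}.
Proof.
by apply/eqP => /mpolyP/(_ U_(i)%MM)/eqP; rewrite mcoeffX mcoeff0 eqxx oner_eq0.
Qed.

(** * Polynomial relations with exponents in a box *)

Section BoxPolynomials.
Variable K : fieldType.
Implicit Types (lam : seq nat -> K) (D r : nat).

(* A polynomial in r variables is encoded by its coefficients, indexed by the
   lists of exponents in the box [0, D[ ^ r. *)
Fixpoint box_eval (m D : nat) lam (fs : seq {mpoly K[m]}) : {mpoly K[m]} :=
  if fs is f :: fs' then
    \sum_(j < D) f ^+ j * box_eval D (fun e => lam ((j : nat) :: e)) fs'
  else (lam [::])%:MP.

Fixpoint box_nonzero D r lam : bool :=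
  if r is r'.+1 then has (fun j => box_nonzero D r' (fun e => lam (j :: e))) (iota 0 D)
  else lam [::] != 0.

Lemma box_nonzeroP D r lam e : size e = r -> all (fun j => (j < D)%N) e -> lam e != 0 ->
  box_nonzero D r lam.
Proof.
elim: r e lam => [|r IH] [|j e] lam //= [sz] /andP[jD eD] le.
by apply/hasP; exists j; [rewrite mem_iota | apply: IH le].
Qed.

Lemma box_eval_eq0 m D lam (fs : seq {mpoly K[m]}) :
  ~~ box_nonzero D (size fs) lam -> box_eval D lam fs = 0.
Proof.
elim: fs lam => [|f fs IH] lam /=; first by move/negPn/eqP => ->; rewrite mpolyC0.
move/hasPn => nz; rewrite big1 // => j _; rewrite IH ?mulr0 //.
by apply: nz; rewrite mem_iota /=.
Qed.

(** Here j is the least exponent of f whose coefficient polynomial is nonzero; the terms above j are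
    absorbed in f * rest. *)
Lemma box_eval_peel m D lam (f : {mpoly K[m]}) fs :
  box_nonzero D (size fs).+1 lam ->
  exists j rest, box_nonzero D (size fs) (fun e => lam (j :: e)) /\
    box_eval D lam (f :: fs) = f ^+ j * (box_eval D (fun e => lam (j :: e)) fs + f * rest).
Proof.
move=> /= nz.
have ex : exists j, (j < D)%N && box_nonzero D (size fs) (fun e => lam (j :: e)).
  by case/hasP: nz => j; rewrite mem_iota => /= jD nzj; exists j; rewrite jD.
case: (ex_minnP ex) => j /andP[jD nzj] jmin; exists j.
exists (\sum_(j.+1 <= i < D) f ^+ (i - j.+1) * box_eval D (fun e => lam (i :: e)) fs).
split=> //; rewrite -(big_mkord xpredT (fun i => f ^+ i * box_eval D (fun e => lam (i :: e)) fs)).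
rewrite (big_cat_nat (n := j)) /=; [|by []|exact: ltnW].
rewrite big_nat big1 ?add0r => [|i /andP[_ ij]]; last first.
  rewrite box_eval_eq0 ?mulr0 //; apply: contraTN (ij) => nzi; rewrite -leqNgt.
  by apply: jmin; rewrite nzi (ltn_trans ij).
rewrite big_ltn // mulrDr; congr (_ + _); rewrite !mulr_sumr big_nat [RHS]big_nat.
apply: eq_bigr => i /andP[ji iD].
by rewrite !mulrA -exprSr -exprD subnKC.
Qed.

(** As f lies outside the prime [C 0], its power cancels; as f lies in [C 1], what remains is there
    a nonzero relation for the shorter chain. The last relation is a nonzero constant in a proper
    ideal. *)
Lemma chain_independent m (C : nat -> {mpoly K[m]} -> Prop) D lam fs :
  (forall i, (i <= size fs)%N -> prime_ideal (C i)) ->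
  (forall i, (i < size fs)%N -> (forall f, C i f -> C i.+1 f) /\ C i.+1 fs`_i /\ ~ C i fs`_i) ->
  box_nonzero D (size fs) lam -> ~ C 0%N (box_eval D lam fs).
Proof.
elim: fs C lam => [|f fs IH] C lam primeC stepC.
  move=> /= nz C0; have [[_ [_ iM]] [C1 _]] := primeC 0%N isT.
  by apply: C1; move: (iM (lam [::])^-1%:MP _ C0); rewrite -mpolyCM mulVf.
move=> nz; have [j [rest [nzj ->]]] := @box_eval_peel m D lam f fs nz.
have [id0 [_ p0]] := primeC 0%N isT; have [sub01 [C1f C0f]] := stepC 0%N isT.
have C0exp i g : C 0%N (f ^+ i * g) -> C 0%N g.
  by elim: i => [|i IHi]; rewrite ?mul1r // exprS -mulrA => /p0[].
move=> /C0exp/sub01 C1; apply: (IH (fun i => C i.+1) (fun e => lam (j :: e))) nzj _.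
- by move=> i ile; apply: primeC.
- by move=> i ile; apply: (stepC i.+1).
have id1 := proj1 (primeC 1%N isT); have [_ [_ iM]] := id1.
rewrite -[box_eval _ _ _](addrK (f * rest)); apply: is_idealB => //.
by rewrite mulrC; apply: iM.
Qed.

(** Regularity cancels the power of f split off by peeling and leaves (A + f rest)^M H in the ideal.
    Modulo f^(N+1) a power of A then kills H, and the remaining sequence is still regular; the
    exponent M serves this induction. *)
Lemma regular_seq_independent m (gs fs : seq {mpoly K[m]}) D lam H M :
  regular_seq gs fs -> box_nonzero D (size fs) lam ->
  in_ideal gs (box_eval D lam fs ^+ M * H) ->
  forall N (I : {mpoly K[m]} -> Prop), is_ideal I -> (forall g, g \in gs -> I g) ->
    (forall f, f \in fs -> I (f ^+ N.+1)) -> I H.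
Proof.
elim: fs gs lam M => [|f fs IH] gs lam M.
  move=> _ /= nz inH N I idI Igs _; apply: in_ideal_min Igs _ _ => //.
  have := in_idealMl ((lam [::])^-1%:MP ^+ M) inH.
  by rewrite mulrA -exprMn -mpolyCM mulVf // expr1n mul1r.
move=> [rf rfs] nz inH N I idI Igs Ifs.
have [j [rest [nzj E]]] := @box_eval_peel m D lam f fs nz.
set A := box_eval _ _ fs in E.
have {}inH : in_ideal gs ((A + f * rest) ^+ M * H).
  move: inH; rewrite E exprMn -exprM -mulrA; elim: (j * M)%N => [|i IHi]; first by rewrite mul1r.
  by rewrite exprS -mulrA => /rf.
apply: (IH (f ^+ N.+1 :: gs) (fun e => lam (j :: e)) (M + N.+1)%N) => //.
- exact: regular_seq_exp.
(* The multipliers that bring H into (f^(N+1)) + [gs] form an ideal. It contains (A + f rest)^M and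
   (- f rest)^(N+1), hence A^(M+N+1). *)
- have idQ : is_ideal (fun x => in_ideal (f ^+ N.+1 :: gs) (x * H)).
    split; first by rewrite mul0r; apply: in_ideal0.
    split=> [a b Ha Hb|a b Hb]; first by rewrite mulrDl; apply: in_idealD.
    by rewrite -mulrA; apply: in_idealMl.
  rewrite -/A -[A](addrK (f * rest)); apply: (is_ideal_expD idQ).
    exact: in_ideal_consW.
  rewrite -mulrN exprMn -!mulrA; apply: in_idealMr; apply: in_ideal_gen.
  by rewrite inE eqxx.
- move=> g; rewrite inE => /orP[/eqP->|]; last exact: Igs.
  by apply: Ifs; rewrite inE eqxx.
by move=> g gfs; apply: Ifs; rewrite inE gfs orbT.
Qed.

End BoxPolynomials.

(** * Fractions over a subalgebra and counting of monomials *)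

Section Dependence.
Variables (K : fieldType) (m : nat).
Notation S := {mpoly K[m]}.
Implicit Types (lam : seq nat -> K) (D r : nat) (B fs : seq S) (I W : S -> Prop).

Inductive in_subalg B : S -> Prop :=
| subalg_gen b of b \in B : in_subalg B b
| subalg_const c : in_subalg B c%:MP
| subalg_add x y of in_subalg B x & in_subalg B y : in_subalg B (x + y)
| subalg_mul x y of in_subalg B x & in_subalg B y : in_subalg B (x * y).

Lemma in_subalg1 B : in_subalg B 1.
Proof. by rewrite -mpolyC1; constructor. Qed.

Lemma in_subalgB B x y : in_subalg B x -> in_subalg B y -> in_subalg B (x - y).
Proof.
move=> Bx By; apply: subalg_add => //; rewrite -mulN1r; apply: subalg_mul => //.
by rewrite -mpolyC1 -mpolyCN; constructor.
Qed.

Lemma in_subalgS B B' x : {subset B <= B'} -> in_subalg B x -> in_subalg B' x.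
Proof.
move=> sub; elim=> [b /sub|c|y z _ ? _ ?|y z _ ? _ ?].
- exact: subalg_gen.
- exact: subalg_const.
- exact: subalg_add.
- exact: subalg_mul.
Qed.

(** [W] is used as the complement of a prime, so this speaks about a localisation without
    constructing it. *)
Definition rational I W B f := exists p q,
  [/\ in_subalg B p, in_subalg B q, W q & I (q * f - p)].

Definition mulclosed W := W 1 /\ forall x y, W x -> W y -> W (x * y).

Section Closure.
Variables (I W : S -> Prop) (B : seq S).
Hypotheses (idI : is_ideal I) (mulW : mulclosed W).

Let I0 : I 0. Proof. by case: idI. Qed.
Let ID x y : I x -> I y -> I (x + y). Proof. by case: idI => _ []; auto. Qed.
Let IM x y : I y -> I (x * y). Proof. by case: idI => _ []; auto. Qed.

Lemma rational_subalg f : in_subalg B f -> rational I W B f.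
Proof.
move=> Bf; exists f, 1; split=> //; [exact: in_subalg1 | exact: mulW.1|].
by rewrite mul1r subrr.
Qed.

Lemma rational_ideal f : I f -> rational I W B f.
Proof.
move=> If; exists 0, 1; split; [|exact: in_subalg1|exact: mulW.1|].
  by rewrite -mpolyC0; constructor.
by rewrite mul1r subr0.
Qed.

Lemma rationalD f g : rational I W B f -> rational I W B g -> rational I W B (f + g).
Proof.
move=> [p [q [Bp Bq Wq If]]] [p' [q' [Bp' Bq' Wq' Ig]]].
exists (q' * p + q * p'), (q * q'); split.
- by apply: subalg_add; apply: subalg_mul.
- exact: subalg_mul.
- exact: mulW.2.
have -> : q * q' * (f + g) - (q' * p + q * p') = q' * (q * f - p) + q * (q' * g - p') by ring.
by apply: ID; apply: IM.
Qed.

Lemma rationalM f g : rational I W B f -> rational I W B g -> rational I W B (f * g).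
Proof.
move=> [p [q [Bp Bq Wq If]]] [p' [q' [Bp' Bq' Wq' Ig]]].
exists (p * p'), (q * q'); split.
- exact: subalg_mul.
- exact: subalg_mul.
- exact: mulW.2.
have -> : q * q' * (f * g) - p * p' = q' * g * (q * f - p) + p * (q' * g - p') by ring.
by apply: ID; apply: IM.
Qed.

Lemma rational_all : (forall i : 'I_m, rational I W B 'X_i) -> forall f, rational I W B f.
Proof.
move=> RX; elim/mpoly_alg_ind => [c|i|f g Rf Rg|f g Rf Rg].
- by apply: rational_subalg; constructor.
- exact: RX.
- exact: rationalD.
- exact: rationalM.
Qed.

Lemma rational_common_denominator fs : (forall f, f \in fs -> rational I W B f) ->
  exists q, [/\ in_subalg B q, W q &
    forall f, f \in fs -> exists2 p, in_subalg B p & I (q * f - p)].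
Proof.
elim: fs => [_|f fs IH Rfs].
  by exists 1; split=> //; [exact: in_subalg1 | exact: mulW.1].
have [|q [Bq Wq qfs]] := IH; first by move=> g gfs; apply: Rfs; rewrite inE gfs orbT.
have [|p [q' [Bp Bq' Wq' If]]] := Rfs f; first by rewrite inE eqxx.
exists (q' * q); split; [exact: subalg_mul|exact: mulW.2|].
move=> g; rewrite inE => /orP[/eqP->|/qfs[p' Bp' Ig]].
  exists (q * p); first exact: subalg_mul.
  have -> : q' * q * f - q * p = q * (q' * f - p) by ring.
  exact: IM.
exists (q' * p'); first exact: subalg_mul.
by rewrite -mulrA -mulrBr; apply: IM.
Qed.

End Closure.

Section Counting.
Variable (n : nat).
Notation T := {mpoly K[n]}.

(* Q ^+ (D * size Ps) times the value of the box polynomial at the Ps / Q. *)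
Fixpoint homog_eval D lam (Q : T) (Ps : seq T) : T :=
  if Ps is P :: Ps' then
    \sum_(j < D) Q ^+ (D - j) * P ^+ j * homog_eval D (fun e => lam ((j : nat) :: e)) Q Ps'
  else (lam [::])%:MP.

Lemma homog_eval_linear D (c : K) lam lam' lam'' (Q : T) Ps :
  (forall e, lam'' e = c * lam e + lam' e) ->
  homog_eval D lam'' Q Ps = c *: homog_eval D lam Q Ps + homog_eval D lam' Q Ps.
Proof.
elim: Ps lam lam' lam'' => [|P Ps IH] lam lam' lam'' E /=.
  by rewrite E mpolyCD mpolyCM mul_mpolyC.
rewrite scaler_sumr -big_split /=; apply: eq_bigr => j _.
by rewrite (IH _ _ _ (fun e => E (_ :: e))) mulrDr scalerAr.
Qed.

(** [msize] is the degree plus one, and 0 for the zero polynomial: a bound by [a.+1] reads degree at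
    most a and covers zero. *)
Lemma msizeM_leS (p q : T) a b : (msize p <= a.+1)%N -> (msize q <= b.+1)%N ->
  (msize (p * q) <= (a + b).+1)%N.
Proof.
have [->|p0] := eqVneq p 0; first by rewrite mul0r msize0.
have [->|q0] := eqVneq q 0; first by rewrite mulr0 msize0.
by rewrite msizeM //; move: (msize p) (msize q) => u v; lia.
Qed.

Lemma msizeX_leS (p : T) a k : (msize p <= a.+1)%N -> (msize (p ^+ k) <= (k * a).+1)%N.
Proof.
move=> pa; elim: k => [|k IH]; first by rewrite expr0 msize1.
by rewrite exprS mulSn; apply: msizeM_leS.
Qed.

Lemma msize_homog_eval D lam (Q : T) Ps a :
  (forall P, P \in Q :: Ps -> (msize P <= a.+1)%N) ->
  (msize (homog_eval D lam Q Ps) <= (size Ps * D * a).+1)%N.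
Proof.
elim: Ps lam => [|P Ps IH] lam szP /=; first by rewrite msizeC; case: (_ != 0).
apply: leq_trans (msize_sum _ _ _) _; apply/bigmax_leqP => j _.
rewrite mulSn mulnDl; apply: msizeM_leS.
  rewrite -[D in (D * a)%N](subnK (ltnW (ltn_ord j))) mulnDl.
  by apply: msizeM_leS; apply: msizeX_leS; apply: szP; rewrite !inE eqxx ?orbT.
by apply: IH => P' P'in; apply: szP; move: P'in; rewrite !inE => /orP[->|->] //; rewrite !orbT.
Qed.

(** Linear algebra: D^r coefficients are free, and vanishing of the value imposes at most (k + 1)^n
    equations, one for each monomial with all exponents at most the degree bound k. *)
Lemma homog_eval_kernel D (Q : T) Ps a :
  (forall P, P \in Q :: Ps -> (msize P <= a.+1)%N) ->
  ((size Ps * D * a).+1 ^ n < D ^ size Ps)%N ->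
  exists2 lam, box_nonzero D (size Ps) lam & homog_eval D lam Q Ps = 0.
Proof.
move=> szP card; set k := (size Ps * D * a)%N in card; set r := size Ps.
pose E := r.-tuple 'I_D; pose M := n.-tuple 'I_k.+1.
(* A vector indexed by the box becomes a coefficient function on lists, zero off the box: at most
   one tuple matches e. *)
pose lam (u : 'rV[K]_#|{: E}|) e := \sum_(t : E | map val t == e) u 0 (enum_rank t).
pose mon (t : M) : 'X_{1..n} := [multinom (tnth t i : nat) | i < n].
pose F (u : 'rV[K]_#|{: E}|) : 'rV[K]_#|{: M}| :=
  \row_j (homog_eval D (lam u) Q Ps)@_(mon (enum_val j)).
have linF : linear F.
  move=> c u v; apply/rowP => j; rewrite !mxE -mcoeffZ -mcoeffD; congr (_@_ _).
  apply: homog_eval_linear => e; rewrite /lam mulr_sumr -big_split /=.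
  by apply: eq_bigr => t _; rewrite !mxE.
pose FL := GRing.isLinear.Build _ _ _ _ F linF.
pose LF : {linear _ -> _} := HB.pack F FL.
have : (0 < \rank (kermx (lin1_mx LF)))%N.
  rewrite mxrank_ker subn_gt0; apply: leq_ltn_trans (rank_leq_col _) _.
  by rewrite !card_tuple !card_ord.
rewrite lt0n mxrank_eq0 => /rowV0Pn[u /sub_kermxP uF u0].
have {uF} uF : F u = 0 by rewrite -[RHS]uF mul_rV_lin1.
exists (lam u).
  have [i ui] : exists i, u 0 i != 0.
    apply/existsP; apply: contraNT u0 => /existsPn u0.
    by apply/eqP/rowP => i; rewrite mxE; apply/eqP; move: (u0 i); rewrite negbK.
  apply: (@box_nonzeroP _ D r (lam u) (map val (enum_val i))).
  - by rewrite size_map size_tuple.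
  - by apply/allP => _ /mapP[x _ ->]; apply: ltn_ord.
  rewrite /lam (big_pred1 (enum_val i)) ?enum_valK // => t.
  by rewrite /= (inj_eq (inj_map val_inj)).
apply/mpolyP => e; rewrite mcoeff0.
have szF : (msize (homog_eval D (lam u) Q Ps) <= k.+1)%N by apply: msize_homog_eval.
have [ek|ke] := leqP k.+1 (mdeg e).
  by apply: memN_msupp_eq0; apply: msize_mdeg_ge; apply: leq_trans szF ek.
have ej j : (e j < k.+1)%N.
  by apply: leq_ltn_trans ke; rewrite mdegE (bigD1 j) //= leq_addr.
pose t : M := [tuple Ordinal (ej j) | j < n].
have -> : e = mon (enum_val (enum_rank t)).
  by rewrite enum_rankK; apply/mnmP => j; rewrite mnmE tnth_mktuple.
by have /rowP/(_ (enum_rank t)) := uF; rewrite !mxE.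
Qed.

End Counting.

Lemma in_subalgP B f : in_subalg B f ->
  exists P : {mpoly K[size B]}, f = mmap (@mpolyC m K) (fun i : 'I_(size B) => B`_i) P.
Proof.
elim=> [b bB|c|x y _ [P ->] _ [Q ->]|x y _ [P ->] _ [Q ->]].
- have iB : (index b B < size B)%N by rewrite index_mem.
  by exists 'X_(Ordinal iB); rewrite mmapX mmap1U /= nth_index.
- by exists c%:MP; rewrite mmapC.
- by exists (P + Q); rewrite mmapD.
- by exists (P * Q); rewrite rmorphM.
Qed.

(** Over a common denominator the elements are P_i / Q in n = [size B] variables. There are more of
    them than variables, so counting gives a relation, and H is the power of Q that clears
    denominators. *)
Lemma rational_dependent I W B fs : is_ideal I -> mulclosed W ->
  (forall f, f \in fs -> rational I W B f) -> (size B < size fs)%N ->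
  exists D lam H, [/\ box_nonzero D (size fs) lam, W H & I (box_eval D lam fs * H)].
Proof.
move=> idI mulW Rfs szB; have [I0 [ID IM]] := idI.
have [q [/in_subalgP[Q ->] Wq qfs]] := rational_common_denominator idI mulW Rfs.
set phi := mmap _ _ in Wq qfs; set n := size B in Q phi qfs Wq szB.
have {qfs}[Ps szPs IPs] : exists2 Ps : seq {mpoly K[n]}, size Ps = size fs &
    forall i, (i < size fs)%N -> I (phi Q * fs`_i - phi Ps`_i).
  elim: (fs) qfs => [|f gs IH] qfs; first by exists [::].
  have [|Ps sz IPs] := IH; first by move=> g ggs; apply: qfs; rewrite inE ggs orbT.
  have [|p /in_subalgP[P ->] IP] := qfs f; first by rewrite inE eqxx.
  by exists (P :: Ps) => [|[|i]] //=; [rewrite sz | apply: IPs].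
pose a := \max_(P <- Q :: Ps) msize P.
have szP P : P \in Q :: Ps -> (msize P <= a.+1)%N.
  by move=> Pin; rewrite leqW // /a; apply: leq_bigmax_seq.
have leqX x y e : (x <= y)%N -> (x ^ e <= y ^ e)%N by case: e => // e; rewrite leq_exp2r.
(* With r = [size Ps]: (r D a + 1)^n <= D^n (r a + 1)^n = D^n (D - 1) < D^(n+1) <= D^r. *)
pose D := ((size Ps * a).+1 ^ n).+1.
have [|lam nz lam0] := homog_eval_kernel (D := D) szP.
  rewrite szPs -szPs; apply: (@leq_trans (D ^ n.+1)); last by rewrite leq_pexp2l // szPs.
  apply: (@leq_ltn_trans ((D * (size Ps * a).+1) ^ n)).
    by apply: leqX; rewrite mulnS -mulnA (mulnCA (size Ps)); lia.
  by rewrite expnMn expnS mulnC ltn_mul2r expn_gt0 /= /D ltnSn.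
rewrite szPs in nz.
exists D, lam, (phi Q ^+ (D * size fs)); split=> //.
  by elim: (D * size fs)%N => [|i IHi]; [exact: mulW.1 | rewrite exprS; apply: mulW.2].
(* Modulo [I], phi P_i equals phi Q times f_i, so the power of Q homogenises the relation. *)
suff : I (box_eval D lam fs * phi Q ^+ (D * size fs) - phi (homog_eval D lam Q Ps)).
  by rewrite lam0 /phi mmap0 subr0.
elim: (fs) (Ps) szPs IPs (lam) => [|f gs IH] [|P Ps'] // szPs IPs lam'.
  by rewrite /= muln0 expr0 mulr1 /phi mmapC subrr.
rewrite /= mulr_suml /phi rmorph_sum /= -sumrB; apply: is_ideal_sum => // j _.
rewrite !rmorphM !rmorphXn /= -/phi; set g := box_eval _ _ _; set h := phi (homog_eval _ _ _ _).
have Igh : I (g * phi Q ^+ (D * size gs) - h).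
  by apply: IH; [case: szPs | move=> i; apply: (IPs i.+1)].
have Ij : I ((phi Q * f) ^+ j - phi P ^+ j).
  by rewrite subrXX mulrC; apply: IM; apply: (IPs 0%N).
have -> : f ^+ j * g * phi Q ^+ (D * (size gs).+1) - phi Q ^+ (D - j) * phi P ^+ j * h =
   phi Q ^+ (D - j) * (phi Q * f) ^+ j * (g * phi Q ^+ (D * size gs) - h)
   + phi Q ^+ (D - j) * h * ((phi Q * f) ^+ j - phi P ^+ j).
  have E : phi Q ^+ D = phi Q ^+ (D - j) * phi Q ^+ j.
    by rewrite -exprD subnK // ltnW.
  rewrite mulnS exprD E exprMn.
  move: (f ^+ j) (phi Q ^+ (D - j)) (phi Q ^+ j) (phi P ^+ j) (_ ^+ (D * _)) (g) (h).
  by move=> x1 x2 x3 x4 x5 x6 x7; ring.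
by apply: ID; apply: IM.
Qed.

End Dependence.

(** * Bounds on depth and dimension *)

Section Bounds.
Variables (K : fieldType) (m : nat).
Notation S := {mpoly K[m]}.
Implicit Types (gs fs ms B : seq S).

Lemma regular_seq_takeP gs fs :
  (forall i, (i < size fs)%N -> regular (gs ++ take i fs) fs`_i) <-> regular_seq gs fs.
Proof.
have move_head f hs hs' : same_ideal (hs ++ f :: hs') ((f :: hs) ++ hs').
  by apply: same_ideal_mem => x; rewrite !(inE, mem_cat); case: (x == f); rewrite ?orbT.
elim: fs gs => [|f fs IH] gs //=; rewrite -IH; split=> [reg|[rf rfs] [|i] /=].
- split=> [|i ilt]; first by have := reg 0%N isT; rewrite take0 cats0.
  by apply: eq_regular (reg i.+1 ilt); apply: move_head.
- by rewrite cats0.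
by move=> ilt; apply: eq_regular (rfs i ilt); apply/same_ideal_sym/move_head.
Qed.

Lemma depth_upper ms gs B (psi : {rmorphism S -> {poly K}}) :
  (forall g, g \in gs -> psi g = 0) -> (forall x, x \in ms -> 'X %| psi x) ->
  (forall i, rational (in_ideal gs) (fun x => psi x != 0) B 'X_i) ->
  ~ depth_ge ms gs (size B).+1.
Proof.
move=> psi_gs psi_ms RX [fs [szfs [fs_ms [/regular_seq_takeP reg _]]]].
have mulW : mulclosed (fun x : S => psi x != 0).
  by split=> [|x y]; rewrite ?rmorph1 ?oner_neq0 // rmorphM /= => ? ?; apply: mulf_neq0.
have idJ := in_ideal_is_ideal gs.
have [|D [lam [H [nz WH JH]]]] :=
  rational_dependent (fs := fs) idJ mulW (fun f _ => rational_all idJ mulW RX f).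
  by rewrite szfs.
have idX k : is_ideal (fun x : S => 'X^k %| psi x).
  split; first by rewrite rmorph0 dvdp0.
  split=> [a b|a b]; first by rewrite rmorphD /=; exact: dvdp_add.
  by rewrite rmorphM /=; apply: dvdp_mull.
(* This exponent exceeds the degree of psi H. *)
have H_in := @regular_seq_independent K m gs fs D lam H 1 reg nz JH (size (psi H)) _
  (idX (size (psi H)).+1).
have : 'X^((size (psi H)).+1) %| psi H.
  apply: H_in => [g /psi_gs ->|f /fs_ms f_in]; first exact: dvdp0.
  rewrite rmorphXn /=; apply: dvdp_exp2r; rewrite -(expr1 'X).
  by apply: (in_ideal_min (idX 1%N)) f_in => x /psi_ms; rewrite expr1.
move/(dvdp_leq WH); by rewrite size_polyXn ltnNge leqnSn.
Qed.

Lemma krull_dim_geW gs d d' : (d' <= d)%N -> krull_dim_ge gs d -> krull_dim_ge gs d'.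
Proof.
move=> le [C [C1 C2]]; exists C; split=> i ile; first by apply: C1; apply: leq_trans ile le.
by apply: C2; apply: leq_trans ile le.
Qed.

Lemma depth_geW ms gs d d' : (d' <= d)%N -> depth_ge ms gs d -> depth_ge ms gs d'.
Proof.
move=> le [fs [sz [fs_ms [reg n1]]]]; exists (take d' fs); split.
  by rewrite size_takel // sz.
split; first by move=> f /mem_take; apply: fs_ms.
split.
  apply/regular_seq_takeP; move/regular_seq_takeP: reg.
  by rewrite -{1}(cat_take_drop d' fs); apply: regular_seq_catl.
apply: contra_not n1; apply: in_ideal_subset => x.
by rewrite !mem_cat => /orP[->//|/mem_take ->]; rewrite orbT.
Qed.

(** Elements picked from the successive differences of a longer chain outnumber [B], hence satisfy a
    relation modulo its bottom prime, against [chain_independent]. *)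
Lemma krull_dim_upper gs d :
  (forall P, prime_ideal P -> (forall f, in_ideal gs f -> P f) ->
     exists2 B, (size B <= d)%N & forall i, rational P (fun x => ~ P x) B 'X_i) ->
  ~ krull_dim_ge gs d.+1.
Proof.
move=> PB [C [C1 C2]].
have [zs szz zsP] : exists2 zs : seq S, size zs = d.+1 &
    forall i, (i < d.+1)%N -> C i.+1 zs`_i /\ ~ C i zs`_i.
  have : (d.+1 <= d.+1)%N by [].
  elim: {1 3 4}d.+1 => [|e IH] ed; first by exists [::].
  have [zs sz zsP] := IH (ltnW ed); have [_ [z zP]] := C2 e ed.
  exists (rcons zs z); first by rewrite size_rcons sz.
  move=> i; rewrite ltnS nth_rcons sz leq_eqVlt => /orP[/eqP->|ie].
    by rewrite ltnn eqxx.
  by rewrite ie; apply: zsP.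
have [pC0 gsC0] := C1 0%N isT; have [idC [nC1 pC]] := pC0.
have [B szB RX] := PB _ pC0 gsC0.
have mulW : mulclosed (fun x => ~ C 0%N x) by split=> // x y nx ny /pC[].
have [|D [lam [H [nz WH /pC[CH|//]]]]] :=
  rational_dependent (fs := zs) idC mulW (fun f _ => rational_all idC mulW RX f).
  by rewrite szz ltnS.
apply: chain_independent nz CH => i ile; rewrite szz in ile; first exact: (C1 i _).1.
by have [sub _] := C2 i ile; split=> //; apply: zsP.
Qed.

Lemma krull_dim_upper_vars gs : ~ krull_dim_ge gs m.+1.
Proof.
apply: krull_dim_upper => P [idP [P1 pP]] _.
exists [seq 'X_i | i <- enum 'I_m]; first by rewrite size_map size_enum_ord.
move=> i; apply: rational_subalg => //.
  by split=> // x y nx ny /pP[].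
by apply: subalg_gen; apply: map_f; rewrite mem_enum.
Qed.

End Bounds.

Lemma mpoly_morph_ext (K : fieldType) (m : nat) (R : comNzRingType)
    (f g : {rmorphism {mpoly K[m]} -> R}) :
  (forall c, f c%:MP = g c%:MP) -> (forall i, f 'X_i = g 'X_i) -> f =1 g.
Proof.
move=> fgC fgX; elim/mpolyind => [|c e p _ _ IH]; first by rewrite !rmorph0.
rewrite !rmorphD /= IH -mul_mpolyC !rmorphM /= fgC mpolyXE_id !rmorph_prod /=.
by congr (_ * _ + _); apply: eq_bigr => i _; rewrite !rmorphXn /= fgX.
Qed.

(** * Chains of primes from a set of vertices *)

Section KrullLower.
(** [U] holds the vertices kept; [r] is constant on the components of the induced subgraph, and [L]
    lists chosen representatives. *)
Variables (K : fieldType) (n : nat) (E : rel 'I_n) (U L : seq 'I_n) (r : 'I_n -> 'I_n).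
Hypotheses (uniqU : uniq U) (uniqL : uniq L) (sLU : {subset L <= U}).
Hypotheses (rL : forall l, l \in L -> r l = l).
Hypothesis (rE : forall u v, u \in U -> v \in U -> E u v -> r u = r v).
Notation S := {mpoly K[n + n]}.
Notation a := (var_a K).
Notation b := (var_b K).

Definition split_vars (R : Type) (fa fb : 'I_n -> R) (i : 'I_(n + n)) : R :=
  match split i with inl v => fa v | inr v => fb v end.

Let subst_of (fa fb : 'I_n -> S) : S -> S := mmap (@mpolyC _ K) (split_vars fa fb).

Let subst_a fa fb v : subst_of fa fb (a v) = fa v.
Proof. by rewrite /subst_of /var_a mmapX mmap1U /split_vars -[lshift _ _]/(unsplit (inl v)) unsplitK. Qed.
Let subst_b fa fb v : subst_of fa fb (b v) = fb v.
Proof. by rewrite /subst_of /var_b mmapX mmap1U /split_vars -[rshift _ _]/(unsplit (inr v)) unsplitK. Qed.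

(** The truncated subtraction keeps all of [U] until [L] is exhausted. *)
Let Ui i := drop (i - size L) U.
Let Li i := drop i L.
(* The generic point of the component of U, with the parameters b_l, l \in L,
   and then the parameters a_u, u \in U, specialised to 0 one by one. *)
Let sg i := subst_of (fun v => if v \in Ui i then a v else 0)
  (fun v => if (v \in Ui i) && (r v \in Li i) then a v * b (r v) else 0).
Let kill i := subst_of (fun v => if v \in Ui i then a v else 0)
  (fun v => if v \in Li i then b v else 0).

(** This gives the inclusion of consecutive kernels: [sg i] takes values in the surviving
    parameters, and [kill i.+1] sets the next one to 0. *)
Let kill_sg i f : kill i.+1 (sg i f) = sg i.+1 f.
Proof.
have UiS v : v \in Ui i.+1 -> v \in Ui i.
  rewrite /Ui; case: (leqP i.+1 (size L)) => h.
    by have -> : (i.+1 - size L = i - size L)%N by lia.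
  by rewrite subSn // -[_.+1]add1n -drop_drop => /mem_drop.
have LiS v : v \in Li i.+1 -> v \in Li i.
  by rewrite /Li -[i.+1]add1n -drop_drop => /mem_drop.
pose F : {rmorphism S -> S} := mmap (@mpolyC _ K) (split_vars (fun v => if v \in Ui i.+1 then a v else 0)
  (fun v => if v \in Li i.+1 then b v else 0)).
pose G : {rmorphism S -> S} := mmap (@mpolyC _ K) (split_vars (fun v => if v \in Ui i then a v else 0)
  (fun v => if (v \in Ui i) && (r v \in Li i) then a v * b (r v) else 0)).
pose G' : {rmorphism S -> S} := mmap (@mpolyC _ K) (split_vars (fun v => if v \in Ui i.+1 then a v else 0)
  (fun v => if (v \in Ui i.+1) && (r v \in Li i.+1) then a v * b (r v) else 0)).
rewrite -[LHS]/((F \o G) f) -[RHS]/(G' f); apply: mpoly_morph_ext => [c|j] /=.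
  by rewrite !mmapC.
rewrite -(splitK j); case: (split j) => v.
  rewrite -[X in mmap _ _ (mmap _ _ X)]/(a v) -[X in _ = mmap _ _ X]/(a v).
  rewrite -!/(subst_of _ _) !subst_a; case: ifP => vU.
    by rewrite subst_a; case: ifP.
  by rewrite /subst_of mmap0; case: ifP => // /UiS; rewrite vU.
rewrite -[X in mmap _ _ (mmap _ _ X)]/(b v) -[X in _ = mmap _ _ X]/(b v).
rewrite -!/(subst_of _ _) !subst_b; case: ifP => vU.
  rewrite /subst_of rmorphM /= -!/(subst_of _ _) subst_a subst_b.
  by case: ifP => //=; rewrite ?mul0r //; case: ifP; rewrite ?mulr0.
rewrite /subst_of mmap0; case: ifP => // /andP[/UiS vU' /LiS rv].
by rewrite vU' rv in vU.
Qed.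

(** The kernels are prime because the target is a domain, and the variable whose parameter is
    dropped at step i separates two consecutive ones. An edge inside [U] maps to a_u a_v (b_(r v) -
    b_(r u)) = 0. *)
Lemma krull_dim_lower : krull_dim_ge (BEI_gens K E) (size L + size U).
Proof.
exists (fun i f => sg i f = 0); split=> i ile.
  have sg0 : sg i 0 = 0 by exact: mmap0.
  have sgD f g : sg i (f + g) = sg i f + sg i g by exact: mmapD.
  have sgM f g : sg i (f * g) = sg i f * sg i g by exact: rmorphM.
  have sgN f : sg i (- f) = - sg i f by exact: mmapN.
  have idsg : is_ideal (fun f => sg i f = 0).
    split=> //; split=> [f g|f g]; first by rewrite sgD => -> ->; rewrite addr0.
    by rewrite sgM => ->; rewrite mulr0.
  split.
    split=> //; split=> [|f g].
      by rewrite -mpolyC1 /sg /subst_of mmapC => /eqP; rewrite mpolyC_eq0 oner_eq0.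
    by rewrite sgM => /eqP; rewrite mulf_eq0 => /orP[]/eqP; [left|right].
  apply: in_ideal_min => // g /mapP[[u v]]; rewrite mem_enum inE /= => /andP[Euv _] ->.
  rewrite sgD sgN !sgM /sg !subst_a !subst_b.
  have [uU|uU] := boolP (u \in Ui i); have [vU|vU] := boolP (v \in Ui i);
    rewrite /= ?mul0r ?mulr0 ?subr0 ?oppr0 //.
  rewrite (rE (mem_drop uU) (mem_drop vU) Euv); case: ifP; rewrite ?mulr0 ?subr0 // => _.
  by rewrite mulrCA subrr.
split=> [f sgf|]; first by rewrite -kill_sg sgf; exact: mmap0.
have X0 (j : 'I_(n + n)) : 'X_j != 0 :> S := mpolyX_neq0 K j.
have notin_drop (x0 : 'I_n) s j : uniq s -> (j < size s)%N -> nth x0 s j \notin drop j.+1 s.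
  by move=> us js; have := drop_uniq j us; rewrite (drop_nth x0 js) => /andP[].
have in_drop (x0 : 'I_n) s j : (j < size s)%N -> nth x0 s j \in drop j s.
  by move=> js; rewrite (drop_nth x0 js) inE eqxx.
have [iL|Li'] := ltnP i (size L).
  have [x0 _] : exists x0 : 'I_n, true by move: iL; case: (L) => // x0; exists x0.
  have lL : nth x0 L i \in L by apply: mem_nth.
  exists (b (nth x0 L i)); rewrite /sg !subst_b rL // /Li (negPf (notin_drop _ _ _ uniqL iL)) andbF.
  split=> //; rewrite in_drop // andbT /Ui.
  have -> : (i - size L = 0)%N by lia.
  by rewrite drop0 sLU // => /eqP; rewrite mulf_eq0 !(negPf (X0 _)).
have iU : (i - size L < size U)%N by lia.
have [x0 _] : exists x0 : 'I_n, true by move: iU; case: (U) => // x0; exists x0.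
exists (a (nth x0 U (i - size L))); rewrite /sg !subst_a /Ui subSn //.
by rewrite (negPf (notin_drop _ _ _ uniqU iU)) in_drop //; split=> // /eqP; rewrite (negPf (X0 _)).
Qed.

End KrullLower.

(** * Generators of residue fields along a path *)

Section PathBound.
Variables (K : fieldType) (n : nat) (P : {mpoly K[n + n]} -> Prop).
Hypothesis primeP : prime_ideal P.
Notation S := {mpoly K[n + n]}.
Notation a := (var_a K).
Notation b := (var_b K).
Notation rat B := (rational P (fun x => ~ P x) B).

Let idP : is_ideal P := primeP.1.
Let prP x y : P (x * y) -> P x \/ P y := primeP.2.2 x y.
Let mulW : mulclosed (fun x => ~ P x).
Proof. by case: primeP => _ [P1 pP]; split=> // x y nx ny /pP[]. Qed.

(** Dividing the fractions puts the numerator p of g into the denominator; p avoids [P] since q g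
    does. *)
Lemma rational_div B f g : rat B g -> ~ P g -> rat B (g * f) -> rat B f.
Proof.
move=> [p [q [Bp Bq Wq Pg]]] nPg [p' [q' [Bp' Bq' Wq' Pgf]]].
have [P0 [PD PM]] := idP.
exists (q * p'), (q' * p); split; [exact: subalg_mul|exact: subalg_mul| |].
  apply: mulW.2 => // Pp; suff /prP[] : P (q * g) by [].
  by rewrite -(subrK p (q * g)); apply: PD.
have -> : q' * p * f - q * p' = q * (q' * (g * f) - p') - q' * f * (q * g - p) by ring.
by apply: is_idealB => //; apply: PM.
Qed.

Lemma rationalS B B' f : {subset B <= B'} -> rat B f -> rat B' f.
Proof.
by move=> sub [p [q [? ? ? ?]]]; exists p, q; split=> //; apply: in_subalgS sub _.
Qed.

(* A vertex whose two variables both lie in P is free of charge and lets its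
   successor be charged twice; any other vertex is charged once, its second
   variable being determined by the edge to its predecessor. *)
Lemma rational_walk v s :
  (forall i, (i < size s)%N ->
     P (a (nth v (v :: s) i) * b (nth v s i) - a (nth v s i) * b (nth v (v :: s) i))) ->
  exists B, [/\ (size B <= (size s).+2)%N,
    P (a (last v s)) -> P (b (last v s)) -> (size B <= (size s).+1)%N &
    forall w, w \in v :: s -> rat B (a w) /\ rat B (b w)].
Proof.
have genR B x : x \in B -> rat B x by move=> xB; apply: rational_subalg => //; apply: subalg_gen.
have idR B x : P x -> rat B x by apply: rational_ideal.
have dead w : (P (a w) /\ P (b w)) \/ ~ (P (a w) /\ P (b w)) by apply: classic.
elim/last_ind: s => [_|s w IH edges].
  have [[Pa Pb]|alive] := dead v.
    exists [::]; split=> // w; rewrite inE => /eqP->; split; exact: idR.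
  exists [:: a v; b v]; split=> //; first by move=> Pa Pb; case: alive.
  by move=> w; rewrite inE => /eqP->; split; apply: genR; rewrite !inE eqxx ?orbT.
have [|B [szB lastB RB]] := IH.
  move=> i ilt; have := edges i; rewrite size_rcons -rcons_cons !nth_rcons ilt.
  by rewrite [size (v :: s)]/= (leqW ilt) => /(_ isT).
rewrite size_rcons last_rcons.
have subB B' : {subset B <= B'} -> rat B' (a w) -> rat B' (b w) ->
    forall u, u \in v :: rcons s w -> rat B' (a u) /\ rat B' (b u).
  move=> sub Ra Rb u; rewrite -rcons_cons mem_rcons inE => /orP[/eqP->//|/RB[? ?]].
  by split; apply: rationalS sub _.
have [[Pa Pb]|alive] := dead w.
  by exists B; split; [exact: leqW|move=> _ _|apply: subB => //; apply: idR].
have Ew : P (a (last v s) * b w - a w * b (last v s)).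
  have := edges (size s); rewrite size_rcons -rcons_cons !nth_rcons ltnn eqxx.
  by rewrite [size (v :: s)]/= ltnSn (nth_last v (v :: s) : nth v (v :: s) (size s) = last v s) => /(_ isT).
have [lastRa lastRb] := RB (last v s) (mem_last v s).
have [[Pa Pb]|alive'] := dead (last v s).
  (* The predecessor left one generator unspent, which pays for both variables of w. *)
  exists [:: a w, b w & B]; split=> /=; first by rewrite !ltnS; apply: lastB.
    by move=> ? ?; case: alive.
  apply: subB; first by move=> x; rewrite !inE => ->; rewrite !orbT.
    by apply: genR; rewrite inE eqxx.
  by apply: genR; rewrite !inE eqxx orbT.
have subc x : {subset B <= x :: B} by move=> y; rewrite inE => ->; rewrite orbT.
(* The edge relation is solved for a_w, dividing by b of the predecessor, if a of the predecessor
   lies in [P], and for b_w otherwise. *)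
have [Pa|nPa] := classic (P (a (last v s))).
  have nPb : ~ P (b (last v s)) by move=> Pb; apply: alive'.
  exists (b w :: B); split=> //; first by move=> ? ?; case: alive.
  have Rb : rat (b w :: B) (b w) by apply: genR; rewrite inE eqxx.
  apply: subB => //.
  apply: (rational_div (g := b (last v s))) => //; first exact: rationalS lastRb.
  rewrite mulrC -(subKr (a (last v s) * b w) (a w * _)).
  rewrite addrC; apply: rationalD => //; last first.
    by apply: rationalM => //; apply: rationalS lastRa.
  by apply: idR; apply: is_idealN.
exists (a w :: B); split=> //; first by move=> ? ?; case: alive.
have Ra : rat (a w :: B) (a w) by apply: genR; rewrite inE eqxx.
apply: subB => //.
apply: (rational_div (g := a (last v s))) => //; first exact: rationalS lastRa.
rewrite -(subrK (a w * b (last v s)) (a (last v s) * b w)).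
apply: rationalD => //; first exact: idR.
by apply: rationalM => //; apply: rationalS lastRb.
Qed.

End PathBound.

(** * The Levi graph *)

Section LeviGraph.
Variables (K : fieldType) (k : nat).
Hypothesis hk : (3 <= k)%N.
Notation S := {mpoly K[(k + k) + (k + k)]}.
Notation J := (BEI_gens K (Gk_edge k)).
Notation a := (var_a K).
Notation b := (var_b K).
Notation x := (@lshift k k).
Notation y := (@rshift k k).
Implicit Types p q : 'I_k.

Lemma Gk_edgeE u v : Gk_edge k u v =
  match split u, split v with
  | inl p, inr q => adjXY p q
  | inr q, inl p => adjXY p q
  | _, _ => false
  end.
Proof.
have geF p : (k <= p)%N = false by rewrite leqNgt ltn_ord.
have ltF p : (k + p < k)%N = false by rewrite ltnNge leq_addr.
rewrite -{1}(splitK u) -{1}(splitK v) /Gk_edge.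
by case: (split u) => p; case: (split v) => q /=;
  rewrite ?geF ?ltF ?ltn_ord ?leq_addr ?addKn ?andbF ?orbF /=.
Qed.

Let split_x p : split (x p) = inl p. Proof. exact: (unsplitK (inl p)). Qed.
Let split_y p : split (y p) = inr p. Proof. exact: (unsplitK (inr p)). Qed.

Lemma Gk_edgeP u v : Gk_edge k u v -> (u < v)%N ->
  exists p q, [/\ u = x p, v = y q & adjXY p q].
Proof.
rewrite Gk_edgeE; move: (splitK u) (splitK v).
case: (split u) => p; case: (split v) => q // <- <- e; first by exists p, q.
by rewrite ltnNge (leq_trans (ltnW (ltn_ord q))) ?leq_addr.
Qed.

Lemma Gk_edge_ideal p q : adjXY p q -> in_ideal J (a (x p) * b (y q) - a (y q) * b (x p)).
Proof.
move=> pq; apply: in_ideal_gen; apply/mapP; exists (x p, y q) => //.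
rewrite mem_enum inE /= Gk_edgeE split_x split_y pq /=.
by apply: leq_trans (ltn_ord p) (leq_addr _ _).
Qed.

(** [i1] is the index of the hubs x_2 and y_2; [i0] and [i2] are two other indices. *)
Let i0 : 'I_k := Ordinal (leq_trans (isT : (0 < 3)%N) hk).
Let i1 : 'I_k := Ordinal (leq_trans (isT : (1 < 3)%N) hk).
Let i2 : 'I_k := Ordinal (leq_trans (isT : (2 < 3)%N) hk).

Lemma Gk_krull_dim_lower : krull_dim_ge J (3 * k.-1).
Proof.
pose I := enum (predC1 i1).
have szI : size I = k.-1 by rewrite -cardE cardC1 card_ord.
pose U := map x I ++ map y I; pose L := map x I.
(* Without the hubs the graph is the matching of the edges x_i - y_i, each represented by x_i. *)
pose r (v : 'I_(k + k)) := match split v with inl i => v | inr j => x j end.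
have rx i : r (x i) = x i by rewrite /r split_x.
have ry i : r (y i) = x i by rewrite /r split_y.
have -> : (3 * k.-1 = size L + size U)%N by rewrite size_cat !size_map szI; lia.
apply: (@krull_dim_lower _ _ _ _ _ r) => //.
- rewrite cat_uniq !map_inj_uniq ?enum_uniq //; [|exact: rshift_inj|exact: lshift_inj].
  rewrite andbT; apply/hasPn => _ /mapP[i _ ->]; apply/mapP => -[j _] /eqP.
  by rewrite eq_rlshift.
- by rewrite map_inj_uniq ?enum_uniq //; apply: lshift_inj.
- by move=> v; rewrite mem_cat => ->.
- by move=> _ /mapP[i _ ->].
have UP v : v \in U -> exists2 i, i != i1 & v = x i \/ v = y i.
  by rewrite mem_cat => /orP[]/mapP[i]; rewrite mem_enum => i_ne ->; exists i; auto.
have adj i j : i != i1 -> j != i1 -> adjXY i j -> i = j.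
  by rewrite -!val_eqE /adjXY /= => /negPf -> /negPf ->; rewrite /= andbT => /eqP/val_inj.
move=> u v /UP[i ni [->|->]] /UP[j nj [->|->]]; rewrite Gk_edgeE ?split_x ?split_y //.
  by move=> /adj -> //; rewrite rx ry.
by move=> /adj -> //; rewrite rx ry.
Qed.

(** Without x_1 and x_2 the graph consists of the isolated vertex y_1 and one further component, so
    this component of the variety has dimension (2k - 2) + 2. [B] lists its parameters. *)
Lemma Gk_depth_upper : ~ depth_ge (all_vars K (k + k)) J (k + k).+1.
Proof.
pose B := [seq a (x i) | i <- enum (predC (pred2 i0 i1))] ++ [seq a (y i) | i <- enum 'I_k]
  ++ [:: b (y i0); b (y i1)].
have szB : size B = (k + k)%N.
  have szC : (2 + size (enum (predC (pred2 i0 i1))))%N = k.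
    by rewrite -cardE -[RHS](card_ord k) -(cardC (pred2 i0 i1)) card2.
  by rewrite /B !size_cat !size_map -enumT size_enum_ord /= addnCA addn2 -add2n szC.
(* The line puts (X, 0) at every vertex, except (X, X) at y_1 and 0 at x_1 and x_2. *)
pose fa (v : 'I_(k + k)) : {poly K} := match split v with inl p => if (p == i0) || (p == i1) then 0 else 'X | inr q => 'X end.
pose fb (v : 'I_(k + k)) : {poly K} := match split v with inl p => 0 | inr q => if q == i0 then 'X else 0 end.
pose psi : {rmorphism S -> {poly K}} := mmap (@polyC K) (split_vars fa fb).
have psia v : psi (a v) = fa v.
  by rewrite /psi /= /var_a mmapX mmap1U /split_vars -[lshift _ _]/(unsplit (inl v)) unsplitK.
have psib v : psi (b v) = fb v.
  by rewrite /psi /= /var_b mmapX mmap1U /split_vars -[rshift _ _]/(unsplit (inr v)) unsplitK.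
have fax p : fa (x p) = if (p == i0) || (p == i1) then 0 else 'X by rewrite /fa split_x.
have fay p : fa (y p) = 'X by rewrite /fa split_y.
have fbx p : fb (x p) = 0 by rewrite /fb split_x.
have fby p : fb (y p) = if p == i0 then 'X else 0 by rewrite /fb split_y.
suff : ~ depth_ge (all_vars K (k + k)) J (size B).+1 by rewrite szB.
apply: (depth_upper (psi := psi)).
- move=> g /mapP[[u v]]; rewrite mem_enum inE /= => /andP[/Gk_edgeP H /H[p [q [-> -> pq]]]] ->.
  rewrite rmorphB !rmorphM /= !psia !psib fbx mulr0 subr0 fax fby.
  case: ifP; rewrite ?mul0r //; case: ifP; rewrite ?mulr0 // => /eqP q0.
  move: pq; rewrite q0 /adjXY -!val_eqE /= => pq /norP[n0 n1].
  by rewrite (negPf n0) (negPf n1) in pq.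
- have dvdX (c : bool) : 'X %| (if c then 0 else 'X : {poly K}) by case: c; rewrite ?dvdp0 ?dvdpp.
  have dvdX' (c : bool) : 'X %| (if c then 'X else 0 : {poly K}) by case: c; rewrite ?dvdp0 ?dvdpp.
  move=> _ /[!mem_cat]/orP[]/mapP[v _ ->].
    by rewrite psia /fa; case: (split v) => p; rewrite ?dvdpp.
  by rewrite psib /fb; case: (split v) => p; rewrite ?dvdp0.
have idJ := in_ideal_is_ideal J; have [J0 [JD JM]] := idJ.
have mulW : mulclosed (fun f : S => psi f != 0).
  by split=> [|f g]; rewrite ?rmorph1 ?oner_neq0 // rmorphM /= => ? ?; apply: mulf_neq0.
have Bax i : i != i0 -> i != i1 -> in_subalg B (a (x i)).
  move=> n0 n1; apply: subalg_gen; rewrite mem_cat (map_f (fun i => a (x i))) // mem_enum.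
  by rewrite !inE negb_or n0 n1.
have Bay i : in_subalg B (a (y i)).
  by apply: subalg_gen; rewrite !mem_cat (map_f (fun i => a (y i))) ?orbT // mem_enum.
have Bb0 : in_subalg B (b (y i0)) by apply: subalg_gen; rewrite !mem_cat !inE eqxx !orbT.
have Bb1 : in_subalg B (b (y i1)) by apply: subalg_gen; rewrite !mem_cat !inE eqxx !orbT.
have gen f : in_subalg B f -> rational (in_ideal J) (fun f => psi f != 0) B f.
  exact: rational_subalg.
have edge p q : adjXY p q -> in_ideal J (a (x p) * b (y q) - a (y q) * b (x p)).
  exact: Gk_edge_ideal.
have X0 : 'X != 0 :> {poly K} by rewrite polyX_eq0.
have Way i : psi (a (y i)) != 0 by rewrite psia fay.
have Wax i : i != i0 -> i != i1 -> psi (a (x i)) != 0.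
  by move=> n0 n1; rewrite psia fax (negPf n0) (negPf n1).
(* Up to sign the determinant of the vectors at y_1 and y_2, both neighbours of x_1; modulo J it
   annihilates the vector at x_1. *)
pose d := a (y i1) * b (y i0) - a (y i0) * b (y i1).
have Bd : in_subalg B d by apply: in_subalgB; apply: subalg_mul.
have Wd : psi d != 0.
  by rewrite rmorphB !rmorphM /= !psia !psib !fay !fby eqxx mulr0 subr0 mulf_neq0.
have vanish h f : in_subalg B h -> psi h != 0 -> in_ideal J (h * f) ->
    rational (in_ideal J) (fun f => psi f != 0) B f.
  move=> Bh Wh hf; exists 0, h; split=> //; last by rewrite subr0.
  by rewrite -mpolyC0; constructor.
have B0 : in_subalg B 0 by rewrite -mpolyC0; constructor.
have n20 : i2 != i0 by []. have n21 : i2 != i1 by [].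
have Rbx i : i != i0 -> i != i1 -> in_ideal J (a (y i1) * b (x i) - a (x i) * b (y i1)).
  move=> n0 n1; rewrite -opprB; apply: in_idealN; apply: (edge).
  by rewrite /adjXY -!val_eqE /= in n1 *; rewrite n1 orbT.
(* The vector at y_i is proportional to that at y_2 through the common neighbour x_i. *)
have Rby i : i != i0 -> i != i1 ->
    in_ideal J (a (y i1) * a (x i) * b (y i) - a (y i) * a (x i) * b (y i1)).
  move=> n0 n1.
  have -> : a (y i1) * a (x i) * b (y i) - a (y i) * a (x i) * b (y i1) =
    a (y i1) * (a (x i) * b (y i) - a (y i) * b (x i)) +
    a (y i) * (a (y i1) * b (x i) - a (x i) * b (y i1)) by ring.
  apply: (JD); apply: (JM); last exact: Rbx.
  by apply: (edge); rewrite /adjXY -val_eqE /= in n1 *; rewrite eqxx n1 !orbT.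
(* x_2 is joined to y_1 and y_3, and the vector at y_3 is proportional to that at y_2, so [d] also
   forces the vector at x_2 to vanish. *)
pose q1 := a (y i2) * a (x i2) * d.
have Bq1 : in_subalg B q1.
  by apply: subalg_mul => //; apply: subalg_mul => //; apply: Bax.
have Wq1 : psi q1 != 0.
  by rewrite rmorphM mulf_neq0 // rmorphM mulf_neq0 //; apply: Wax.
have ax1 : in_ideal J (q1 * a (x i1)).
  have -> : q1 * a (x i1) = a (y i1) * a (x i2) *
      (a (y i2) * (a (x i1) * b (y i0) - a (y i0) * b (x i1))
       - a (y i0) * (a (x i1) * b (y i2) - a (y i2) * b (x i1)))
    + a (x i1) * a (y i0) *
      (a (y i1) * a (x i2) * b (y i2) - a (y i2) * a (x i2) * b (y i1)).
    by rewrite /q1 /d; ring.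
  apply: (JD); last by apply: (JM); apply: Rby.
  by apply: (JM); apply: in_idealB; apply: (JM); apply: (edge).
move=> j; rewrite -(splitK j); case: (split j) => v; rewrite -(splitK v); case: (split v) => i.
- change (rational (in_ideal J) (fun f => psi f != 0) B (a (x i))).
  have [->|n0] := eqVneq i i0.
    apply: (vanish d) => //.
    have -> : d * a (x i0) = a (y i1) * (a (x i0) * b (y i0) - a (y i0) * b (x i0))
      - a (y i0) * (a (x i0) * b (y i1) - a (y i1) * b (x i0)) by rewrite /d; ring.
    by apply: in_idealB; apply: (JM); apply: (edge).
  have [->|n1] := eqVneq i i1; first exact: (vanish q1).
  by apply: gen; apply: Bax.
- by apply: gen; apply: Bay.
- change (rational (in_ideal J) (fun f => psi f != 0) B (b (x i))).
  have [->|n0] := eqVneq i i0.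
    apply: (vanish d) => //.
    have -> : d * b (x i0) = b (y i1) * (a (x i0) * b (y i0) - a (y i0) * b (x i0))
      - b (y i0) * (a (x i0) * b (y i1) - a (y i1) * b (x i0)) by rewrite /d; ring.
    by apply: in_idealB; apply: (JM); apply: (edge).
  have [->|n1] := eqVneq i i1.
    apply: (vanish (q1 * a (y i0))); first exact: subalg_mul.
      by rewrite rmorphM mulf_neq0.
    have -> : q1 * a (y i0) * b (x i1) = b (y i0) * (q1 * a (x i1))
      - q1 * (a (x i1) * b (y i0) - a (y i0) * b (x i1)) by ring.
    by apply: in_idealB; apply: (JM) => //; apply: (edge).
  exists (a (x i) * b (y i1)), (a (y i1)); split=> //; last exact: Rbx.
  by apply: subalg_mul => //; apply: Bax.
change (rational (in_ideal J) (fun f => psi f != 0) B (b (y i))).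
have [->|n0] := eqVneq i i0; first exact: gen.
have [->|n1] := eqVneq i i1; first exact: gen.
exists (a (y i) * a (x i) * b (y i1)), (a (y i1) * a (x i)); split=> //.
- by apply: subalg_mul => //; apply: subalg_mul => //; apply: Bax.
- by apply: subalg_mul => //; apply: Bax.
- by rewrite rmorphM mulf_neq0 //; apply: Wax.
exact: Rby.
Qed.

End LeviGraph.

(** * The hexagon, the case k = 3 *)

Section Hexagon.
Variable K : fieldType.
Notation S := {mpoly K[(3 + 3) + (3 + 3)]}.
Notation J := (BEI_gens K (Gk_edge 3)).
Notation a := (var_a K).
Notation b := (var_b K).

(* The hexagon is hex 0 - hex 1 - ... - hex 5 - hex 0. *)
Definition hex (i : nat) : 'I_(3 + 3) := inord (nth 0%N [:: 0; 3; 1; 5; 2; 4]%N i).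

Let hexE i : (i < 6)%N -> hex i = nth 0%N [:: 0; 3; 1; 5; 2; 4]%N i :> nat.
Proof. by move=> i6; rewrite /hex inordK //; case: i i6 => [|[|[|[|[|[|]]]]]]. Qed.

Lemma hexP (w : 'I_(3 + 3)) : exists2 i, (i < 6)%N & w = hex i.
Proof.
have i6 : (index (w : nat) [:: 0; 3; 1; 5; 2; 4]%N < 6)%N.
  by case: w => [[|[|[|[|[|[|]]]]]]].
exists (index (w : nat) [:: 0; 3; 1; 5; 2; 4]%N) => //; apply/val_inj.
by rewrite /= hexE //; case: w {i6} => [[|[|[|[|[|[|]]]]]]].
Qed.

Definition hex_minor (i j : nat) : S :=
  a (hex i) * b (hex j) - a (hex j) * b (hex i).

Lemma hex_minor_ideal i j : (i < 6)%N -> (j < 6)%N ->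
  (j == i.+1) || (i == 0%N) && (j == 5%N) -> in_ideal J (hex_minor i j).
Proof.
have edge u v : Gk_edge 3 u v -> in_ideal J (a u * b v - a v * b u).
  move=> E; have [uv|vu|uv] := ltngtP u v.
  - by apply: in_ideal_gen; apply/mapP; exists (u, v); rewrite ?mem_enum ?inE /= ?E.
  - rewrite -opprB; apply: in_idealN; apply: in_ideal_gen; apply/mapP.
    by exists (v, u) => //; rewrite mem_enum inE /= vu andbT /Gk_edge orbC; apply: E.
  by move/val_inj: uv => ->; rewrite [a v * _]mulrC subrr; apply: in_ideal0.
move=> i6 j6 ij; apply: edge; rewrite /Gk_edge !hexE //.
by move: i6 j6 ij; case: i => [|[|[|[|[|[|]]]]]] // _; case: j => [|[|[|[|[|[|]]]]]].
Qed.

Lemma BEI_hexE : same_ideal J (hex_minor 0 5 :: [seq hex_minor i i.+1 | i <- iota 0 5]).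
Proof.
apply: same_ideal_gens => f; last first.
  rewrite inE => /orP[/eqP->|/mapP[i]]; first exact: hex_minor_ideal.
  by rewrite mem_iota => /= i5 ->; apply: hex_minor_ideal; rewrite ?eqxx //; lia.
case/mapP=> -[u v]; rewrite mem_enum inE => /= /andP[E uv] ->.
have [i i6 ui] := hexP u; have [j j6 vj] := hexP v; subst u v.
have min i' : (i' < 5)%N -> in_ideal (hex_minor 0 5 :: [seq hex_minor i i.+1 | i <- iota 0 5]) (hex_minor i' i'.+1).
  move=> i5; apply: in_ideal_gen; rewrite inE (map_f (fun i => hex_minor i i.+1)) ?orbT //.
  by rewrite mem_iota.
have min' i' j' : hex_minor i' j' = - hex_minor j' i' by rewrite opprB /hex_minor; ring.
have min0 : in_ideal (hex_minor 0 5 :: [seq hex_minor i i.+1 | i <- iota 0 5]) (hex_minor 0 5).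
  by apply: in_ideal_gen; rewrite inE eqxx.
change (in_ideal (hex_minor 0 5 :: [seq hex_minor i i.+1 | i <- iota 0 5]) (hex_minor i j)).
have : [|| j == i.+1, i == j.+1, (i == 0%N) && (j == 5%N) | (i == 5%N) && (j == 0%N)].
  by move: E; rewrite /Gk_edge !hexE //; move: i6 j6 {uv};
     case: i => [|[|[|[|[|[|]]]]]] // _; case: j => [|[|[|[|[|[|]]]]]].
case/or4P=> [/eqP ji|/eqP ij|/andP[/eqP-> /eqP->]|/andP[/eqP-> /eqP->]] //.
- by rewrite ji; apply: min; rewrite ji in j6.
- by rewrite ij (min' j.+1); apply: in_idealN; apply: min; rewrite ij in i6.
by rewrite (min' 5); apply: in_idealN.
Qed.

(** The walk through all six vertices has five steps, hence at most 5 + 2 generators. *)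
Lemma hex_krull_dim_upper : ~ krull_dim_ge J 8.
Proof.
apply: krull_dim_upper => P primeP JP.
have [|B [szB _ RB]] := rational_walk primeP (v := hex 0) (s := map hex (iota 1 5)).
  move=> i; rewrite size_map size_iota => i5; apply: JP.
  have := @hex_minor_ideal i i.+1; rewrite /hex_minor eqxx /= ltnS => /(_ (leqW i5) i5 isT).
  by case: i i5 => [|[|[|[|[|]]]]].
exists B; first by rewrite size_map size_iota in szB.
have hexin (w : 'I_(3 + 3)) : w \in hex 0 :: map hex (iota 1 5).
  by have [i i6 ->] := hexP w; rewrite -[_ :: _]/(map hex (iota 0 6)) map_f ?mem_iota.
move=> j; rewrite -(splitK j); case: (split j) => w /=.
  exact: (RB w (hexin w)).1.
exact: (RB w (hexin w)).2.
Qed.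

End Hexagon.

(** * Graded ideals and colon ideals *)

Section Homogeneous.
Variables (K : fieldType) (m : nat).
Notation S := {mpoly K[m]}.
Implicit Types (gs fs : seq S) (f g h p q x y z : S).

Lemma pihomogM_homog d e p q : q \is e.-homog ->
  pihomog mdeg d (p * q) = if (e <= d)%N then pihomog mdeg (d - e) p * q else 0.
Proof.
move=> hq; rewrite {1}(pihomog_partitionE (leqnn (mmeasure mdeg p))) mulr_suml raddf_sum /=.
have hom i : pihomog mdeg i p * q \is (i + e).-homog by rewrite dhomogM ?pihomogP.
have pi_eq i : pihomog mdeg d (pihomog mdeg i p * q) =
    if (i + e == d)%N then pihomog mdeg i p * q else 0.
  by case: eqP => [<-|/eqP ne]; [exact: pihomog_dE | exact: pihomog_ne0 ne (hom i)].
rewrite (eq_bigr (fun i : 'I_ _ => if (i + e == d)%N then pihomog mdeg i p * q else 0)); last by [].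
case: ifP => [ed|ed]; last first.
  by rewrite big1 // => i _; case: eqP => // E; rewrite -E leq_addl in ed.
have [lt|ge] := ltnP (d - e) (mmeasure mdeg p).
  rewrite (bigD1 (Ordinal lt)) //= subnK // eqxx big1 ?addr0 // => i ne.
  by case: eqP => // E; case/eqP: ne; apply/val_inj; rewrite /= -E addnK.
rewrite big1 => [|i _]; last first.
  by case: eqP => // E; move: (ltn_ord i); rewrite ltnNge (leq_trans ge) // -E addnK.
rewrite pihomogE big_seq_cond big_pred0 ?mul0r // => u.
by apply/negP => /andP[/msize_mdeg_lt lt /eqP E]; rewrite E ltnNge ge in lt.
Qed.

Definition homogeneous gs := forall g, g \in gs -> exists d, g \is d.-homog.

Lemma homogeneous_cons g gs d : g \is d.-homog -> homogeneous gs -> homogeneous (g :: gs).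
Proof. by move=> hg hgs h; rewrite inE => /orP[/eqP->|/hgs //]; exists d. Qed.

Lemma pihomog_in_ideal gs d f : homogeneous gs -> in_ideal gs f -> in_ideal gs (pihomog mdeg d f).
Proof.
move=> hgs [cs ->]; rewrite raddf_sum /=; apply: is_ideal_sum => [|i _].
  exact: in_ideal_is_ideal.
have gi : gs`_i \in gs by apply: mem_nth.
have [e /pihomogM_homog ->] := hgs _ gi; case: ifP => _; last exact: in_ideal0.
by apply: in_idealMl; apply: in_ideal_gen.
Qed.

(* The graded case of Krull's intersection theorem. *)
Lemma homogeneous_separated gs z f : homogeneous gs -> z \is 1.-homog ->
  (forall N, exists r, in_ideal gs (f - r * z ^+ N)) -> in_ideal gs f.
Proof.
move=> hgs hz sep; rewrite (pihomog_partitionE (leqnn (mmeasure mdeg f))).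
apply: is_ideal_sum => [|[d lt] _ /=]; first exact: in_ideal_is_ideal.
(* This N exceeds d, so r z^N has no part of degree d. *)
have [r /(pihomog_in_ideal d hgs)] := sep (mmeasure mdeg f).
rewrite raddfB /= (@pihomogM_homog d (mmeasure mdeg f)).
  by rewrite leqNgt lt /= subr0.
by rewrite -[X in X.-homog]mul1n; apply: dhomogMn.
Qed.

(** If y f = 0 modulo [gs], then x divides f, and cancelling x shows that y kills the quotient as
    well. Repeating this puts f in every power of x. *)
Lemma regular_homogeneous gs x y : homogeneous gs -> x \is 1.-homog ->
  regular gs x -> regular (x :: gs) y -> regular gs y.
Proof.
move=> hgs hx rx ry f yf; apply: (homogeneous_separated hgs hx) => N.
suff [r [fr yr]] : exists r, in_ideal gs (f - r * x ^+ N) /\ in_ideal gs (y * r) by exists r.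
elim: N => [|N [r [fr yr]]]; first by exists f; rewrite mulr1 subrr; split=> //; apply: in_ideal0.
have /ry/in_ideal_cons[s rs] : in_ideal (x :: gs) (y * r) by apply: in_ideal_consW.
exists s; split.
  have -> : f - s * x ^+ N.+1 = (f - r * x ^+ N) + (r - s * x) * x ^+ N by rewrite exprS; ring.
  by apply: in_idealD => //; apply: in_idealMr.
apply: rx; have -> : x * (y * s) = y * r - y * (r - s * x) by ring.
by apply: in_idealB => //; apply: in_idealMl.
Qed.

(** x passes one element at a time: [regular_homogeneous] makes that element regular without x, and
    [regular_swap] makes x regular after it. *)
Lemma regular_seq_rot gs x fs : homogeneous gs -> x \is 1.-homog ->
  (forall f, f \in fs -> f \is 1.-homog) ->
  regular_seq gs (x :: fs) -> regular_seq gs (rcons fs x).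
Proof.
elim: fs gs => //= f fs IH gs hgs hx hfs [rx [rf rfs]].
have hf : f \is 1.-homog by apply: hfs; rewrite inE eqxx.
split; first exact: regular_homogeneous rx rf.
apply: IH => //; first exact: homogeneous_cons hf _.
  by move=> g gfs; apply: hfs; rewrite inE gfs orbT.
split; first exact: regular_swap.
by apply: eq_regular_seq rfs; apply: same_ideal_mem => g; rewrite !inE orbCA.
Qed.

(** If g r = 0 modulo [gs], then r = s z up to [ms] by the description modulo z; cancelling z in z g
    s = 0 gives g s = 0. Repeating this puts f in [ms] up to every power of z. *)
Lemma colon_descent gs ms g z : homogeneous (ms ++ gs) -> z \is 1.-homog ->
  regular gs z -> (forall u, u \in ms -> in_ideal gs (g * u)) ->
  (forall f, in_ideal (z :: gs) (g * f) -> in_ideal (ms ++ z :: gs) f) ->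
  forall f, in_ideal gs (g * f) -> in_ideal (ms ++ gs) f.
Proof.
move=> hgs hz rz gms colon f gf; apply: (homogeneous_separated hgs hz) => N.
suff [r [fr gr]] : exists r, in_ideal (ms ++ gs) (f - r * z ^+ N) /\ in_ideal gs (g * r).
  by exists r.
have sub h : in_ideal gs h -> in_ideal (ms ++ gs) h.
  by apply: in_ideal_subset => u; rewrite mem_cat => ->; rewrite orbT.
have gmsgs h := in_ideal_colon (f := h) gms.
elim: N => [|N [r [fr gr]]]; first by exists f; rewrite mulr1 subrr; split=> //; apply: in_ideal0.
have : in_ideal (z :: ms ++ gs) r.
  have /colon : in_ideal (z :: gs) (g * r) by apply: in_ideal_consW.
  by apply: in_ideal_subset => u; rewrite !(inE, mem_cat) orbCA.
case/in_ideal_cons=> s rs; exists s; split.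
  have -> : f - s * z ^+ N.+1 = (f - r * z ^+ N) + (r - s * z) * z ^+ N by rewrite exprS; ring.
  by apply: in_idealD => //; apply: in_idealMr.
apply: rz; have -> : z * (g * s) = g * r - g * (r - s * z) by ring.
by apply: in_idealB => //; apply: gmsgs.
Qed.

(** In z f = p g the factor p lies in the colon ideal modulo z, so p = s z up to elements that g
    kills, and z cancels in z (f - s g). *)
Lemma regular_colon gs ms g z : regular gs z ->
  (forall u, u \in ms -> in_ideal gs (g * u)) ->
  (forall f, in_ideal (z :: gs) (g * f) -> in_ideal (ms ++ z :: gs) f) ->
  regular (g :: gs) z.
Proof.
move=> rz gms colon f /in_ideal_cons[p zfp].
have : in_ideal (z :: ms ++ gs) p.
  have /colon : in_ideal (z :: gs) (g * p).
    apply/in_ideal_cons; exists f; rewrite -opprB; apply: in_idealN.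
    by rewrite mulrC [g * p]mulrC.
  by apply: in_ideal_subset => u; rewrite !(inE, mem_cat) orbCA.
have gmsgs h := in_ideal_colon (f := h) gms.
case/in_ideal_cons=> s ps; apply/in_ideal_cons; exists s; apply: rz.
have -> : z * (f - s * g) = (z * f - p * g) + g * (p - s * z) by ring.
by apply: in_idealD => //; apply: gmsgs.
Qed.

End Homogeneous.

(** * The binomial edge ideal of a path *)

Section PathIdeal.
Variables (K : fieldType) (m : nat).
Notation S := {mpoly K[m]}.

Definition kill_var (x : 'I_m) : S -> S :=
  mmap (@mpolyC m K) (fun i => if i == x then 0 else 'X_i).

Lemma kill_varX x i : kill_var x 'X_i = if i == x then 0 else 'X_i.
Proof. by rewrite /kill_var mmapX mmap1U. Qed.
Lemma kill_varM x : {morph kill_var x : f g / f * g}.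
Proof. by move=> f g; rewrite /kill_var rmorphM. Qed.
Lemma kill_varB x : {morph kill_var x : f g / f - g}.
Proof. by move=> f g; rewrite /kill_var rmorphB. Qed.

(** Each member h of the ideal is its value at x = 0 plus x r with r again in the ideal. For h = x f
    the value is 0, so r = f. *)
Lemma regular_free_var (gs : seq S) x : (forall g, g \in gs -> kill_var x g = g) ->
  regular gs 'X_x.
Proof.
move=> free f Xf.
have decomp h : exists r, h = kill_var x h + 'X_x * r.
  elim/mpoly_alg_ind: h => [c|i|h h' [r hr] [r' hr']|h h' [r hr] [r' hr']].
  - by exists 0; rewrite mulr0 addr0 /kill_var mmapC.
  - rewrite kill_varX; case: eqP => [->|_]; first by exists 1; rewrite add0r mulr1.
    by exists 0; rewrite mulr0 addr0.
  - by exists (r + r'); rewrite {1}hr {1}hr' /kill_var mmapD; ring.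
  exists (r * kill_var x h' + kill_var x h * r' + 'X_x * r * r').
  by rewrite {1}hr {1}hr' kill_varM; ring.
pose I h := in_ideal gs h /\ exists2 r, in_ideal gs r & h = kill_var x h + 'X_x * r.
have [_ [r gr E]] : I ('X_x * f).
  apply: in_ideal_min Xf => [|g ggs]; last first.
    split; first exact: in_ideal_gen.
    by exists 0; [exact: in_ideal0|rewrite free // mulr0 addr0].
  split; first by split; [|exists 0]; rewrite ?mulr0 ?addr0 /kill_var ?mmap0 //; apply: in_ideal0.
  split=> [h h' [gh [r gr E]] [gh' [r' gr' E']]|h h' [gh [r gr E]]].
    split; first exact: in_idealD.
    exists (r + r'); first exact: in_idealD.
    by rewrite {1}E {1}E' /kill_var mmapD; ring.
  split; first exact: in_idealMl.
  have [t Et] := decomp h.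
  exists (t * kill_var x h' + kill_var x h * r + 'X_x * t * r).
    apply: in_idealD; last exact: in_idealMl.
    apply: in_idealD; last exact: in_idealMl.
    apply: in_idealMl; have -> : kill_var x h' = h' - 'X_x * r by rewrite {2}E; ring.
    by apply: in_idealB => //; apply: in_idealMl.
  by rewrite {1}E {1}Et kill_varM; ring.
rewrite kill_varM kill_varX eqxx mul0r add0r in E.
by rewrite (mulfI (mpolyX_neq0 K x) E).
Qed.

Variables (N : nat) (al be : nat -> 'I_m).
Hypothesis al_inj : forall i j, (i <= N)%N -> (j <= N)%N -> al i = al j -> i = j.
Hypothesis be_inj : forall i j, (i <= N)%N -> (j <= N)%N -> be i = be j -> i = j.
Hypothesis al_be : forall i j, al i != be j.
Notation a i := ('X_(al i) : S).
Notation b i := ('X_(be i) : S).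

Definition path_minor i : S := a i * b i.+1 - a i.+1 * b i.
Definition path_minors i l : seq S := [seq path_minor t | t <- iota i l].

(** [vs] collects the variables set to 0 at earlier vertices of the path. *)
Definition avoids (vs : seq 'I_m) i l :=
  forall t, (i <= t <= i + l)%N -> (al t \notin vs) && (be t \notin vs).

Let X (i : 'I_m) : S := 'X_i.

Let kill_X x i : x != i -> kill_var x (X i) = X i.
Proof. by rewrite /X kill_varX eq_sym => /negPf ->. Qed.

Let kill_vs x (vs : seq 'I_m) g : x \notin vs -> g \in map X vs -> kill_var x g = g.
Proof.
by move=> xvs /mapP[i ivs ->]; apply: kill_X; apply: contraNneq xvs => ->.
Qed.

Let kill_minors x i l g : (forall t, (i <= t <= i + l)%N -> (x != al t) && (x != be t)) ->
  g \in path_minors i l -> kill_var x g = g.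
Proof.
move=> xi /mapP[t]; rewrite mem_iota => /andP[it tl] ->.
have /andP[n1 n2] : (x != al t) && (x != be t) by apply: xi; lia.
have /andP[n3 n4] : (x != al t.+1) && (x != be t.+1) by apply: xi; lia.
by rewrite /path_minor kill_varB !kill_varM -!/(X _) !kill_X.
Qed.

(** Modulo b_i the first minor is a_i b_(i+1), where a_i is free and b_(i+1) is regular by
    induction, b_i having joined [vs]. So the minor is regular after b_i, and the two are
    swapped. *)
Lemma path_first_regular l i vs : (i + l <= N)%N -> avoids vs i l ->
  regular (map X vs ++ path_minors i l) (b i).
Proof.
elim: l i vs => [|l IH] i vs iN av.
  apply: regular_free_var => g; rewrite cats0; apply: kill_vs.
  by have /andP[] : (al i \notin vs) && (be i \notin vs) by apply: av; lia.
have [ai bi] : al i \notin vs /\ be i \notin vs by apply/andP; apply: av; lia.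
have far t : (i.+1 <= t <= i.+1 + l)%N -> (t != i) && (t <= N)%N by lia.
have bfree : regular (map X vs ++ path_minors i.+1 l) (b i).
  apply: regular_free_var => g; rewrite mem_cat => /orP[]; first exact: kill_vs.
  apply: kill_minors => t /far/andP[ti tN]; rewrite eq_sym al_be /=.
  by apply: contraNneq ti => /be_inj -> //; lia.
have : regular (path_minor i :: map X vs ++ path_minors i.+1 l) (b i).
  apply: regular_swap => // f qf.
  have : in_ideal (map X (be i :: vs) ++ path_minors i.+1 l) (b i.+1 * f).
    have afree : regular (map X (be i :: vs) ++ path_minors i.+1 l) (a i).
      apply: regular_free_var => g; rewrite mem_cat => /orP[].
        by apply: kill_vs; rewrite inE negb_or al_be.
      apply: kill_minors => t /far/andP[ti tN]; rewrite al_be andbT.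
      by apply: contraNneq ti => /al_inj -> //; lia.
    apply: afree.
    have -> : a i * (b i.+1 * f) = path_minor i * f + a i.+1 * f * b i.
      by rewrite /path_minor; ring.
    apply: in_idealD => //; apply: in_idealMl; apply: in_ideal_gen.
    by rewrite inE eqxx.
  apply: IH; first by lia.
  move=> t tl; have /andP[ti tN] := far t tl.
  rewrite !inE !negb_or al_be /=; have /andP[-> ->] : (al t \notin vs) && (be t \notin vs).
    by apply: av; lia.
  by rewrite andbT; apply: contraNneq ti => /be_inj -> //; lia.
apply: eq_regular; apply: same_ideal_mem => g.
by rewrite /path_minors [iota i l.+1]/= !(inE, mem_cat) orbCA.
Qed.

Definition path_params i l : seq S := [seq a t - b t.+1 | t <- iota i l] ++ [:: a (i + l)].

(** Modulo b_i the first minor is a_i b_(i+1), and a_i, b_(i+1) are regular in either order over the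
    rest, which makes z = a_i - b_(i+1) regular. Modulo z the product becomes b_(i+1)^2, and
    [regular_seq_exp] reduces the square to the shorter path. *)
Lemma path_params_regular l i vs : (i + l <= N)%N -> avoids vs i l ->
  regular_seq (b i :: map X vs ++ path_minors i l) (path_params i l).
Proof.
elim: l i vs => [|l IH] i vs iN av.
  split=> //; rewrite addn0 cats0 -[_ :: _]/(map X (be i :: vs)).
  apply: regular_free_var => g; apply: kill_vs; rewrite inE negb_or al_be /=.
  by have /andP[] : (al i \notin vs) && (be i \notin vs) by apply: av; lia.
have far t : (i.+1 <= t <= i.+1 + l)%N -> (t != i) && (t <= N)%N by lia.
have [ai bi] : al i \notin vs /\ be i \notin vs by apply/andP; apply: av; lia.
have av' ws : {subset ws <= [:: al i, be i & vs]} -> avoids ws i.+1 l.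
  move=> sub t tl; have /andP[ti tN] := far t tl.
  have /andP[na nb] : (al t \notin vs) && (be t \notin vs) by apply: av; lia.
  apply/andP; split; apply/negP => /sub; rewrite !inE ?(negPf na) ?(negPf nb) ?orbF.
    rewrite (negPf (al_be _ _)) orbF => /eqP/al_inj E; case/eqP: ti; apply: E; lia.
  rewrite eq_sym (negPf (al_be _ _)) /= => /eqP/be_inj E; case/eqP: ti; apply: E; lia.
pose I := map X (be i :: vs) ++ path_minors i.+1 l.
pose Ia := map X [:: al i, be i & vs] ++ path_minors i.+1 l.
have bI : regular I (b i.+1).
  by apply: path_first_regular; [lia|apply: av' => t; rewrite !inE => ->; rewrite orbT].
have bIa : regular Ia (b i.+1).
  by apply: path_first_regular; [lia|apply: av' => t].
have afree ws : al i \notin ws -> regular (map X ws ++ path_minors i.+1 l) (a i).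
  move=> aws; apply: regular_free_var => g; rewrite mem_cat => /orP[]; first exact: kill_vs.
  apply: kill_minors => t /far/andP[ti tN]; rewrite al_be andbT.
  by apply: contraNneq ti => /al_inj -> //; lia.
have aI : regular I (a i) by apply: afree; rewrite inE negb_or al_be.
have aIb : regular (b i.+1 :: I) (a i).
  by apply: (afree [:: be i.+1, be i & vs]); rewrite !inE !negb_or !al_be.
pose z := a i - b i.+1.
have gens : same_ideal (b i :: map X vs ++ path_minors i l.+1) (a i * b i.+1 :: I).
  have bG hs : in_ideal (b i :: hs) (b i) by apply: in_ideal_gen; rewrite inE eqxx.
  apply: same_ideal_gens => g; rewrite ?(inE, mem_cat) /=.
    case/or3P=> [/eqP->||]; first by apply: in_ideal_consW; apply: bG.
      by move=> gvs; apply: in_ideal_gen; rewrite !(inE, mem_cat) gvs !orbT.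
    case/orP=> [/eqP->|gl]; last by apply: in_ideal_gen; rewrite !(inE, mem_cat) gl !orbT.
    apply: in_idealB; first by apply: in_ideal_gen; rewrite inE eqxx.
    by apply: in_idealMl; apply: in_ideal_consW; apply: bG.
  case/or4P=> [/eqP->|/eqP->||]; [|exact: bG| |].
  - rewrite -(subrK (a i.+1 * b i) (a i * b i.+1)); apply: in_idealD.
      by apply: in_ideal_gen; rewrite !(inE, mem_cat) eqxx !orbT.
    exact: in_idealMl.
  - by move=> gvs; apply: in_ideal_gen; rewrite !(inE, mem_cat) gvs !orbT.
  by move=> gl; apply: in_ideal_gen; rewrite !(inE, mem_cat) gl !orbT.
have -> : path_params i l.+1 = z :: path_params i.+1 l by rewrite /path_params /= addSnnS.
apply: eq_regular_seq (same_ideal_sym gens) _; split.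
  (* Reduction modulo a_i gives f = h a_i up to I; then a_i^2 h in the ideal puts a_i h, and hence
     h, in (b_(i+1)) + I. *)
  move=> f zf.
  have : in_ideal (a i :: I) f.
    have : in_ideal Ia (b i.+1 * f).
      have -> : b i.+1 * f = a i * f - z * f by rewrite /z; ring.
      apply: in_idealB; first by apply: in_idealMr; apply: in_ideal_gen; rewrite inE eqxx.
      apply: in_ideal_sub zf => g; rewrite inE => /orP[/eqP->|gI].
        by apply: in_idealMr; apply: in_ideal_gen; rewrite inE eqxx.
      by apply: in_ideal_gen; rewrite inE gI orbT.
    exact: bIa.
  case/in_ideal_cons=> h fh.
  have {}zf : in_ideal (a i * b i.+1 :: I) (a i * (a i * h)).
    have -> : a i * (a i * h) = z * f - z * (f - h * a i) + h * (a i * b i.+1) by rewrite /z; ring.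
    apply: in_idealD; last by apply: in_idealMl; apply: in_ideal_gen; rewrite inE eqxx.
    by apply: in_idealB => //; apply: in_idealMl; apply: in_ideal_consW.
  have /aIb/in_ideal_cons[s hs] : in_ideal (b i.+1 :: I) (a i * h).
    case/in_ideal_cons: zf => s hs; apply/in_ideal_cons; exists s; apply: aI.
    by rewrite mulrBr [a i * (s * _)]mulrCA.
  apply/in_ideal_cons; exists s.
  have -> : f - s * (a i * b i.+1) = (f - h * a i) + a i * (h - s * b i.+1) by ring.
  by apply: in_idealD => //; apply: in_idealMl.
have zb : regular (z :: I) (b i.+1).
  apply: regular_swap => // f zf; apply: aIb.
  have -> : a i * f = z * f + f * b i.+1 by rewrite /z; ring.
  by apply: in_idealD => //; apply: in_idealMl; apply: in_ideal_gen; rewrite inE eqxx.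
have : regular_seq (b i.+1 ^+ 2 :: z :: I) (path_params i.+1 l).
  apply: regular_seq_exp => //.
  have := IH i.+1 [:: al i, be i & vs]; have -> : (i.+1 + l = i + l.+1)%N by lia.
  move/(_ iN (av' _ (fun _ => id))); apply: eq_regular_seq.
  have bG hs : in_ideal (b i.+1 :: hs) (b i.+1) by apply: in_ideal_gen; rewrite inE eqxx.
  apply: same_ideal_gens => g; rewrite /I /= !inE.
    case/or3P=> [/eqP->|/eqP->|gI]; [exact: bG| |].
      have -> : X (al i) = z + b i.+1 by rewrite /X /z subrK.
      apply: in_idealD => //.
      by apply: in_ideal_gen; rewrite !inE eqxx orbT.
    by apply: in_ideal_gen; rewrite !inE gI !orbT.
  case/or3P=> [/eqP->|/eqP->|gI]; [exact: bG| |].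
    apply: in_idealB => //; by apply: in_ideal_gen; rewrite !inE eqxx orbT.
  by apply: in_ideal_gen; rewrite !inE gI !orbT.
apply: eq_regular_seq; apply: same_ideal_gens => g; rewrite !inE.
  case/or3P=> [/eqP->|/eqP->|gI].
  - have -> : b i.+1 ^+ 2 = a i * b i.+1 - z * b i.+1 by rewrite /z; ring.
    apply: in_idealB; last by apply: in_idealMr; apply: in_ideal_gen; rewrite inE eqxx.
    by apply: in_ideal_gen; rewrite !inE eqxx orbT.
  - by apply: in_ideal_gen; rewrite !inE eqxx.
  by apply: in_ideal_gen; rewrite !inE gI !orbT.
case/or3P=> [/eqP->|/eqP->|gI].
- by apply: in_ideal_gen; rewrite !inE eqxx orbT.
- have -> : a i * b i.+1 = z * b i.+1 + b i.+1 ^+ 2 by rewrite /z; ring.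
  apply: in_idealD; last by apply: in_ideal_gen; rewrite !inE eqxx.
  by apply: in_idealMr; apply: in_ideal_gen; rewrite !inE eqxx orbT.
by apply: in_ideal_gen; rewrite !inE gI !orbT.
Qed.

Lemma path_ideal_regular_seq :
  regular_seq (path_minors 0 N) (b 0 :: path_params 0 N).
Proof.
split; first by apply: (@path_first_regular N 0 [::]).
by apply: (@path_params_regular N 0 [::]).
Qed.

End PathIdeal.

(** * The depth of the hexagon *)

Section CyclicRelations.
Variables (R : comNzRingType) (gs : seq R) (b : nat -> R).
Hypothesis r1 : in_ideal gs (b 1 ^+ 2 - b 0 * b 2).
Hypothesis r2 : in_ideal gs (b 2 ^+ 2 - b 1 * b 3).
Hypothesis r3 : in_ideal gs (b 3 ^+ 2 - b 2 * b 4).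
Hypothesis r4 : in_ideal gs (b 4 ^+ 2 - b 3 * b 5).
Hypothesis r5 : in_ideal gs (b 5 ^+ 2 - b 4 * b 0).

Definition omit (s : nat) : R :=
  match s with
  | 1 => b 2 * b 3 * b 4 * b 5
  | 2 => b 1 * b 3 * b 4 * b 5
  | 3 => b 1 * b 2 * b 4 * b 5
  | 4 => b 1 * b 2 * b 3 * b 5
  | _ => b 1 * b 2 * b 3 * b 4
  end.

Definition full : R := b 1 * b 2 * b 3 * b 4 * b 5.

Lemma mul_omit s : (1 <= s <= 5)%N -> b s * omit s = full.
Proof. by rewrite /full; case: s => [|[|[|[|[|[|]]]]]] //= _; rewrite /omit; ring. Qed.

Ltac combine :=
  repeat (first [apply: in_idealD | apply: in_idealN]); apply: in_idealMl;
  first [exact: r1 | exact: r2 | exact: r3 | exact: r4 | exact: r5].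

(* In the monoid with c_j^2 = c_(j-1) c_(j+1), indices mod 6, the weight
   \sum_j j mod 6 is conserved, which determines the omitted index. *)
Lemma mul_omit_reduce i s : (1 <= i <= 5)%N -> (1 <= s <= 5)%N -> i != s ->
  exists2 s', (1 <= s' <= 5)%N & in_ideal gs (b i * omit s - b 0 * omit s').
Proof.
case: i => [|[|[|[|[|[|]]]]]] // _; case: s => [|[|[|[|[|[|]]]]]] // _ // _.
- exists 1%N => //.
  have -> : b 1 * omit 2 - b 0 * omit 1 =
    b 3 * b 4 * b 5 * (b 1 ^+ 2 - b 0 * b 2) by rewrite /omit; ring.
  by combine.
- exists 2%N => //.
  have -> : b 1 * omit 3 - b 0 * omit 2 =
    b 2 * b 4 * b 5 * (b 1 ^+ 2 - b 0 * b 2) + b 0 * b 4 * b 5 * (b 2 ^+ 2 - b 1 * b 3).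
    by rewrite /omit; ring.
  by combine.
- exists 3%N => //.
  have -> : b 1 * omit 4 - b 0 * omit 3 =
    b 2 * b 3 * b 5 * (b 1 ^+ 2 - b 0 * b 2) + b 0 * b 3 * b 5 * (b 2 ^+ 2 - b 1 * b 3)
      + b 0 * b 1 * b 5 * (b 3 ^+ 2 - b 2 * b 4).
    by rewrite /omit; ring.
  by combine.
- exists 4%N => //.
  have -> : b 1 * omit 5 - b 0 * omit 4 =
    b 2 * b 3 * b 4 * (b 1 ^+ 2 - b 0 * b 2) + b 0 * b 3 * b 4 * (b 2 ^+ 2 - b 1 * b 3)
      + b 0 * b 1 * b 4 * (b 3 ^+ 2 - b 2 * b 4) + b 0 * b 1 * b 2 * (b 4 ^+ 2 - b 3 * b 5).
    by rewrite /omit; ring.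
  by combine.
- exists 5%N => //.
  have -> : b 2 * omit 1 - b 0 * omit 5 =
    b 3 * b 4 * b 5 * (b 2 ^+ 2 - b 1 * b 3) + b 1 * b 4 * b 5 * (b 3 ^+ 2 - b 2 * b 4)
      + b 1 * b 2 * b 5 * (b 4 ^+ 2 - b 3 * b 5) + b 1 * b 2 * b 3 * (b 5 ^+ 2 - b 4 * b 0).
    by rewrite /omit; ring.
  by combine.
- exists 1%N => //.
  have -> : b 2 * omit 3 - b 0 * omit 1 =
    b 1 * b 4 * b 5 * (b 2 ^+ 2 - b 1 * b 3) + b 3 * b 4 * b 5 * (b 1 ^+ 2 - b 0 * b 2).
    by rewrite /omit; ring.
  by combine.
- exists 2%N => //.
  have -> : b 2 * omit 4 - b 0 * omit 2 =
    b 1 * b 3 * b 5 * (b 2 ^+ 2 - b 1 * b 3) + b 3 * b 3 * b 5 * (b 1 ^+ 2 - b 0 * b 2)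
      + b 0 * b 2 * b 5 * (b 3 ^+ 2 - b 2 * b 4) + b 0 * b 4 * b 5 * (b 2 ^+ 2 - b 1 * b 3).
    by rewrite /omit; ring.
  by combine.
- exists 3%N => //.
  have -> : b 2 * omit 5 - b 0 * omit 3 =
    b 1 * b 3 * b 4 * (b 2 ^+ 2 - b 1 * b 3) + b 3 * b 3 * b 4 * (b 1 ^+ 2 - b 0 * b 2)
      + b 0 * b 2 * b 4 * (b 3 ^+ 2 - b 2 * b 4) + b 0 * b 4 * b 4 * (b 2 ^+ 2 - b 1 * b 3)
      + b 0 * b 1 * b 3 * (b 4 ^+ 2 - b 3 * b 5) + b 0 * b 1 * b 5 * (b 3 ^+ 2 - b 2 * b 4).
    by rewrite /omit; ring.
  by combine.
- exists 4%N => //.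
  have -> : b 3 * omit 1 - b 0 * omit 4 =
    b 2 * b 4 * b 5 * (b 3 ^+ 2 - b 2 * b 4) + b 4 * b 4 * b 5 * (b 2 ^+ 2 - b 1 * b 3)
      + b 1 * b 3 * b 5 * (b 4 ^+ 2 - b 3 * b 5) + b 1 * b 5 * b 5 * (b 3 ^+ 2 - b 2 * b 4)
      + b 1 * b 2 * b 4 * (b 5 ^+ 2 - b 4 * b 0) + b 0 * b 1 * b 2 * (b 4 ^+ 2 - b 3 * b 5).
    by rewrite /omit; ring.
  by combine.
- exists 5%N => //.
  have -> : b 3 * omit 2 - b 0 * omit 5 =
    b 1 * b 4 * b 5 * (b 3 ^+ 2 - b 2 * b 4) + b 1 * b 2 * b 5 * (b 4 ^+ 2 - b 3 * b 5)
      + b 1 * b 2 * b 3 * (b 5 ^+ 2 - b 4 * b 0).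
    by rewrite /omit; ring.
  by combine.
- exists 1%N => //.
  have -> : b 3 * omit 4 - b 0 * omit 1 =
    b 1 * b 2 * b 5 * (b 3 ^+ 2 - b 2 * b 4) + b 1 * b 4 * b 5 * (b 2 ^+ 2 - b 1 * b 3)
      + b 3 * b 4 * b 5 * (b 1 ^+ 2 - b 0 * b 2).
    by rewrite /omit; ring.
  by combine.
- exists 2%N => //.
  have -> : b 3 * omit 5 - b 0 * omit 2 =
    b 1 * b 2 * b 4 * (b 3 ^+ 2 - b 2 * b 4) + b 1 * b 4 * b 4 * (b 2 ^+ 2 - b 1 * b 3)
      + b 3 * b 4 * b 4 * (b 1 ^+ 2 - b 0 * b 2) + b 0 * b 2 * b 3 * (b 4 ^+ 2 - b 3 * b 5)
      + b 0 * b 2 * b 5 * (b 3 ^+ 2 - b 2 * b 4) + b 0 * b 4 * b 5 * (b 2 ^+ 2 - b 1 * b 3).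
    by rewrite /omit; ring.
  by combine.
- exists 3%N => //.
  have -> : b 4 * omit 1 - b 0 * omit 3 =
    b 2 * b 3 * b 5 * (b 4 ^+ 2 - b 3 * b 5) + b 2 * b 5 * b 5 * (b 3 ^+ 2 - b 2 * b 4)
      + b 4 * b 5 * b 5 * (b 2 ^+ 2 - b 1 * b 3) + b 1 * b 3 * b 4 * (b 5 ^+ 2 - b 4 * b 0)
      + b 0 * b 1 * b 3 * (b 4 ^+ 2 - b 3 * b 5) + b 0 * b 1 * b 5 * (b 3 ^+ 2 - b 2 * b 4).
    by rewrite /omit; ring.
  by combine.
- exists 4%N => //.
  have -> : b 4 * omit 2 - b 0 * omit 4 =
    b 1 * b 3 * b 5 * (b 4 ^+ 2 - b 3 * b 5) + b 1 * b 5 * b 5 * (b 3 ^+ 2 - b 2 * b 4)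
      + b 1 * b 2 * b 4 * (b 5 ^+ 2 - b 4 * b 0) + b 0 * b 1 * b 2 * (b 4 ^+ 2 - b 3 * b 5).
    by rewrite /omit; ring.
  by combine.
- exists 5%N => //.
  have -> : b 4 * omit 3 - b 0 * omit 5 =
    b 1 * b 2 * b 5 * (b 4 ^+ 2 - b 3 * b 5) + b 1 * b 2 * b 3 * (b 5 ^+ 2 - b 4 * b 0).
    by rewrite /omit; ring.
  by combine.
- exists 1%N => //.
  have -> : b 4 * omit 5 - b 0 * omit 1 =
    b 1 * b 2 * b 3 * (b 4 ^+ 2 - b 3 * b 5) + b 1 * b 2 * b 5 * (b 3 ^+ 2 - b 2 * b 4)
      + b 1 * b 4 * b 5 * (b 2 ^+ 2 - b 1 * b 3) + b 3 * b 4 * b 5 * (b 1 ^+ 2 - b 0 * b 2).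
    by rewrite /omit; ring.
  by combine.
- exists 2%N => //.
  have -> : b 5 * omit 1 - b 0 * omit 2 =
    b 2 * b 3 * b 4 * (b 5 ^+ 2 - b 4 * b 0) + b 0 * b 2 * b 3 * (b 4 ^+ 2 - b 3 * b 5)
      + b 0 * b 2 * b 5 * (b 3 ^+ 2 - b 2 * b 4) + b 0 * b 4 * b 5 * (b 2 ^+ 2 - b 1 * b 3).
    by rewrite /omit; ring.
  by combine.
- exists 3%N => //.
  have -> : b 5 * omit 2 - b 0 * omit 3 =
    b 1 * b 3 * b 4 * (b 5 ^+ 2 - b 4 * b 0) + b 0 * b 1 * b 3 * (b 4 ^+ 2 - b 3 * b 5)
      + b 0 * b 1 * b 5 * (b 3 ^+ 2 - b 2 * b 4).
    by rewrite /omit; ring.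
  by combine.
- exists 4%N => //.
  have -> : b 5 * omit 3 - b 0 * omit 4 =
    b 1 * b 2 * b 4 * (b 5 ^+ 2 - b 4 * b 0) + b 0 * b 1 * b 2 * (b 4 ^+ 2 - b 3 * b 5).
    by rewrite /omit; ring.
  by combine.
- exists 5%N => //.
  have -> : b 5 * omit 4 - b 0 * omit 5 =
    b 1 * b 2 * b 3 * (b 5 ^+ 2 - b 4 * b 0) by rewrite /omit; ring.
  by combine.
Qed.

(** In c_1 c_5 c_1^2 c_5^2 the two squares are replaced by c_0 c_2 and c_4 c_0. *)
Lemma cube_reduce : in_ideal gs ((b 1 * b 5) ^+ 3 - b 0 ^+ 2 * omit 3).
Proof.
have -> : (b 1 * b 5) ^+ 3 - b 0 ^+ 2 * omit 3 =
  b 1 * b 5 * b 5 ^+ 2 * (b 1 ^+ 2 - b 0 * b 2) + b 1 * b 5 * b 0 * b 2 * (b 5 ^+ 2 - b 4 * b 0).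
  by rewrite /omit; ring.
by combine.
Qed.

End CyclicRelations.

(** * A linear form detecting the product c_1 c_2 c_3 c_4 c_5 *)

Section Functional.
Variable K : fieldType.
Notation T := {mpoly K[6]}.
Notation X i := ('X_(inord i) : T).
Local Notation nu e i := ((e : 'X_{1..6}) (inord i)).

(* The exponents occurring in the class of c_1 c_2 c_3 c_4 c_5 modulo the
   relations with c_0 = 0; all other monomials of that degree and weight vanish. *)
Definition socle_exponent (e : 'X_{1..6}) : bool :=
  [&& nu e 0 == 0, nu e 1 <= 1, nu e 5 <= 1,
      nu e 1 + nu e 2 + nu e 3 + nu e 4 + nu e 5 == 5 &
      nu e 1 + 2 * nu e 2 + 3 * nu e 3 + 4 * nu e 4 + 5 * nu e 5 == 15]%N.

(** The monomials selected all have degree 5, so the range of degrees below 6 loses none. *)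
Definition socle_form (f : T) : K := \sum_(e : 'X_{1..6 < 6} | socle_exponent e) f@_e.

Lemma socle_formD f g : socle_form (f + g) = socle_form f + socle_form g.
Proof. by rewrite -big_split /=; apply: eq_bigr => e _; rewrite mcoeffD. Qed.

Lemma socle_formZ c f : socle_form (c *: f) = c * socle_form f.
Proof. by rewrite mulr_sumr; apply: eq_bigr => e _; rewrite mcoeffZ. Qed.

Lemma mdeg6 (e : 'X_{1..6}) :
  mdeg e = (nu e 0 + (nu e 1 + nu e 2 + nu e 3 + nu e 4 + nu e 5))%N.
Proof.
rewrite mdegE (eq_bigr (fun i : 'I_6 => nu e i)); last by move=> i _; rewrite inord_val.
by rewrite !big_ord_recl big_ord0 /= /bump /= addn0 !addnA addn0.
Qed.

Lemma socle_formX e : socle_form 'X_[e] = (socle_exponent e)%:R.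
Proof.
rewrite /socle_form; have [se|nse] := boolP (socle_exponent e); last first.
  rewrite big1 // => u su; rewrite mcoeffX; case: eqP => // E.
  by rewrite E su in nse.
have e6 : (mdeg e < 6)%N.
  by rewrite mdeg6; case/and5P: se => /eqP-> _ _ /eqP-> _.
rewrite (bigD1 (BMultinom e6)) //= mcoeffX eqxx big1 ?addr0 // => u /andP[_ ne].
by rewrite mcoeffX; case: eqP => // E; case/eqP: ne; apply/val_inj.
Qed.

Let nuU i j : (i < 6)%N -> (j < 6)%N -> nu U_(inord i)%MM j = (i == j).
Proof. by move=> i6 j6; rewrite mnm1E -val_eqE /= !inordK. Qed.

Lemma socle_form_binomial (u v : 'X_{1..6}) :
  (forall e, socle_exponent (e + u)%MM = socle_exponent (e + v)%MM) ->
  forall f, socle_form (f * ('X_[u] - 'X_[v])) = 0.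
Proof.
move=> uv; elim/mpolyind => [|c e p _ _ IH]; first by rewrite mul0r /socle_form big1 // => e _; rewrite mcoeff0.
rewrite mulrDl socle_formD IH addr0 -scalerAl socle_formZ mulrBr -!mpolyXD.
rewrite socle_formD -scaleN1r socle_formZ !socle_formX uv mulN1r subrr mulr0 //.
Qed.

Lemma socle_form_monomial (u : 'X_{1..6}) :
  (forall e, socle_exponent (e + u)%MM = false) -> forall f, socle_form (f * 'X_[u]) = 0.
Proof.
move=> u0; elim/mpolyind => [|c e p _ _ IH]; first by rewrite mul0r /socle_form big1 // => e _; rewrite mcoeff0.
by rewrite mulrDl socle_formD IH addr0 -scalerAl socle_formZ -mpolyXD socle_formX u0 mulr0.
Qed.

(** [socle_form] vanishes on all multiples of the generators and is 1 on the product. *)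
Lemma full_notin_reduced :
  ~ in_ideal [:: X 0; X 1 ^+ 2 - X 0 * X 2; X 2 ^+ 2 - X 1 * X 3; X 3 ^+ 2 - X 2 * X 4;
                 X 4 ^+ 2 - X 3 * X 5; X 5 ^+ 2 - X 4 * X 0] (full (fun i => X i)).
Proof.
move=> fullI; have tau0 : forall h, socle_form (h * full (fun i => X i)) = 0.
  apply: (in_ideal_min (I := fun f => forall h, socle_form (h * f) = 0)) fullI => [|g].
    split; first by move=> h; rewrite mulr0 /socle_form big1 // => e _; rewrite mcoeff0.
    split=> [f g f0 g0 h|f g g0 h]; first by rewrite mulrDr socle_formD f0 g0 addr0.
    by rewrite mulrA g0.
  have XX i j : X i * X j = 'X_[U_(inord i) + U_(inord j)] by rewrite mpolyXD.
  rewrite !inE => /orP[/eqP->|/orP g_in].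
    apply: socle_form_monomial => e; rewrite /socle_exponent !mnmDE !nuU //=; lia.
  (* In the first and last relation both monomials are excluded. The others preserve degree and
     weight; in c_2^2 = c_1 c_3 a further factor c_1 would leave weight 10 for two factors, so
     c_5^2, which is excluded on both sides. The case of c_4^2 is symmetric. *)
  case: g_in => [/eqP->|/or4P[]/eqP->]; rewrite expr2 !XX; apply: socle_form_binomial => e;
    rewrite /socle_exponent !mnmDE !nuU //=; lia.
have := tau0 1; rewrite mul1r /full -!mpolyXD socle_formX.
have -> : socle_exponent (U_(inord 1) + U_(inord 2) + U_(inord 3) + U_(inord 4) + U_(inord 5))%MM.
  by rewrite /socle_exponent !mnmDE !nuU.
by move/eqP; rewrite oner_eq0.
Qed.

End Functional.

(** * Regularity of c_0 modulo the omitted products *)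

Section OmitIdeal.
Variables (K : fieldType) (m : nat) (gs : seq {mpoly K[m]}) (b : nat -> {mpoly K[m]}).
Notation S := {mpoly K[m]}.
Hypothesis r1 : in_ideal gs (b 1 ^+ 2 - b 0 * b 2).
Hypothesis r2 : in_ideal gs (b 2 ^+ 2 - b 1 * b 3).
Hypothesis r3 : in_ideal gs (b 3 ^+ 2 - b 2 * b 4).
Hypothesis r4 : in_ideal gs (b 4 ^+ 2 - b 3 * b 5).
Hypothesis r5 : in_ideal gs (b 5 ^+ 2 - b 4 * b 0).
Hypothesis vars : forall i, exists2 j, (j <= 5)%N & in_ideal gs ('X_i - b j).
Hypothesis b0_regular : regular gs (b 0).
Hypothesis full_notin : ~ in_ideal (b 0 :: gs) (full b).

Let omits : seq S := [seq omit b s | s <- iota 1 5].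

Let omits_mem s : (1 <= s <= 5)%N -> omit b s \in omits.
Proof. by move=> s5; apply: map_f; rewrite mem_iota. Qed.

Let reduce i s := @mul_omit_reduce S gs b r1 r2 r3 r4 r5 i s.

(** A normal form modulo [gs] for the ideal of the omitted products: modulo b_0 times that ideal,
    six scalars determine an element. *)
Let in_span (x : S) := exists lam (mu : K) y,
  in_ideal omits y /\
  in_ideal gs (x - (\sum_(1 <= s < 6) (lam s)%:MP * omit b s + mu%:MP * full b + b 0 * y)).

Let spanD x x' : in_span x -> in_span x' -> in_span (x + x').
Proof.
move=> [lam [mu [y [yO E]]]] [lam' [mu' [y' [yO' E']]]].
exists (fun s => lam s + lam' s), (mu + mu'), (y + y'); split; first exact: in_idealD.
have -> : \sum_(1 <= s < 6) (lam s + lam' s)%:MP * omit b s =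
  \sum_(1 <= s < 6) (lam s)%:MP * omit b s + \sum_(1 <= s < 6) (lam' s)%:MP * omit b s.
  by rewrite -big_split /=; apply: eq_bigr => s _; rewrite mpolyCD mulrDl.
move: E E'; set u := \sum_(_ <= _ < _) _; set v := \sum_(_ <= _ < _) _ => E E'.
rewrite mpolyCD; have -> : x + x' - (u + v + (mu%:MP + mu'%:MP) * full b + b 0 * (y + y')) =
  (x - (u + mu%:MP * full b + b 0 * y)) + (x' - (v + mu'%:MP * full b + b 0 * y')) by ring.
exact: in_idealD.
Qed.

Let spanC (c : K) x : in_span x -> in_span (c%:MP * x).
Proof.
move=> [lam [mu [y [yO E]]]].
exists (fun s => c * lam s), (c * mu), (c%:MP * y); split; first exact: in_idealMl.
have -> : \sum_(1 <= s < 6) (c * lam s)%:MP * omit b s =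
    c%:MP * \sum_(1 <= s < 6) (lam s)%:MP * omit b s.
  by rewrite mulr_sumr; apply: eq_bigr => s _; rewrite mpolyCM mulrA.
rewrite mpolyCM -!mulrA [b 0 * _]mulrCA -!mulrDr -mulrBr; exact: in_idealMl.
Qed.

Let span_gs x : in_ideal gs x -> in_span x.
Proof.
move=> xgs; exists (fun=> 0), 0, 0; split; first exact: in_ideal0.
by rewrite big1 => [|s _]; rewrite mpolyC0 mul0r // mulr0 !addr0 subr0.
Qed.

Let span_b0 y : in_ideal omits y -> in_span (b 0 * y).
Proof.
move=> yO; exists (fun=> 0), 0, y; split=> //.
rewrite big1 => [|s _]; rewrite mpolyC0 mul0r // !add0r subrr; exact: in_ideal0.
Qed.

Let span_eq x x' : in_ideal gs (x - x') -> in_span x' -> in_span x.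
Proof. by move=> /span_gs ? ?; rewrite -(subrK x' x); apply: spanD. Qed.

Let span_full : in_span (full b).
Proof.
exists (fun=> 0), 1, 0; split; first exact: in_ideal0.
rewrite big1 => [|s _]; last by rewrite mpolyC0 mul0r.
by rewrite mpolyC1 mul1r mulr0 addr0 add0r subrr; apply: in_ideal0.
Qed.

Let span_omit s : (1 <= s <= 5)%N -> in_span (omit b s).
Proof.
move=> s5; exists (fun t => (t == s)%:R), 0, 0; split; first exact: in_ideal0.
rewrite (bigD1_seq s) ?mem_index_iota ?iota_uniq //= eqxx mpolyC1 mul1r.
rewrite big1 => [|t /negPf ->]; last by rewrite mpolyC0 mul0r.
by rewrite mpolyC0 mul0r mulr0 !addr0 subrr; apply: in_ideal0.
Qed.

Let span_b_omit i s : (i <= 5)%N -> (1 <= s <= 5)%N -> in_span (b i * omit b s).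
Proof.
move=> i5 s5; have omO := in_ideal_gen (omits_mem s5).
have [->|i0] := posnP i; first exact: span_b0.
have [->|ne] := eqVneq i s; first by rewrite mul_omit //; apply: span_full.
have [|s' s'5 E] := @reduce i s _ s5 ne; first by rewrite i0.
by apply: (span_eq E); apply: span_b0; apply: in_ideal_gen; apply: omits_mem.
Qed.

(* full = b s * omit s with s != i *)
Let span_b_full i : (i <= 5)%N -> in_span (b i * full b).
Proof.
move=> i5; have [->|i0] := posnP i.
  by apply: span_b0; rewrite -(@mul_omit _ b 1) //; apply: in_idealMl; apply: in_ideal_gen; apply: omits_mem.
have [s s5 ne] : exists2 s, (1 <= s <= 5)%N & i != s.
  by have [->|ne] := eqVneq i 1%N; [exists 2%N | exists 1%N].
have [|s' s'5 E] := @reduce i s _ s5 ne; first by rewrite i0.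
apply: (@span_eq _ (b 0 * (b s * omit b s'))).
  have -> : b i * full b - b 0 * (b s * omit b s') = b s * (b i * omit b s - b 0 * omit b s').
    by rewrite -(mul_omit b s5); ring.
  exact: in_idealMl.
by apply: span_b0; apply: in_idealMl; apply: in_ideal_gen; apply: omits_mem.
Qed.

Let span_b i x : (i <= 5)%N -> in_span x -> in_span (b i * x).
Proof.
move=> i5 [lam [mu [y [yO E]]]].
apply: (@span_eq _ (b i * (\sum_(1 <= s < 6) (lam s)%:MP * omit b s + mu%:MP * full b + b 0 * y))).
  by rewrite -mulrBr; apply: in_idealMl.
rewrite !mulrDr mulr_sumr; apply: (spanD); first apply: (spanD).
- rewrite big_nat; elim/big_rec: _ => [|s x' s5 Sx']; first exact/span_gs/in_ideal0.
  by apply: (spanD) => //; rewrite mulrCA; apply: spanC; apply: span_b_omit.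
- by rewrite mulrCA; apply: spanC; apply: span_b_full.
by rewrite mulrCA; apply: span_b0; apply: in_idealMl.
Qed.

(** Multiplication by each b_i preserves the span, and every variable is some b_i modulo [gs]. *)
Let span_ideal : is_ideal in_span.
Proof.
split; first exact/span_gs/in_ideal0.
split=> [x x'|f x Sx]; first exact: spanD.
elim/mpoly_alg_ind: f x Sx => [c|i|f g IHf IHg|f g IHf IHg] x Sx.
- exact: spanC.
- have [j j5 E] := vars i; apply: (@span_eq _ (b j * x)); last exact: span_b.
  by rewrite -mulrBl; apply: in_idealMr.
- by rewrite mulrDl; apply: spanD; [apply: IHf|apply: IHg].
by rewrite -mulrA; apply: IHf; apply: IHg.
Qed.

Let full_coef (c : K) : in_ideal (b 0 :: gs) (c%:MP * full b) -> c = 0.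
Proof.
move=> cf; apply/eqP; apply: contra_notT full_notin => c0.
by rewrite -[full b]mul1r -mpolyC1 -(mulVf c0) mpolyCM -mulrA; apply: in_idealMl.
Qed.

(** Write b_0 f in normal form. Modulo b_0, multiplying by b_t leaves only lam_t times [full], so
    every lam_t vanishes, and then mu. There remains b_0 f = b_0 y, where b_0 cancels. *)
Lemma omit_regular : regular (omits ++ gs) (b 0).
Proof.
move=> f bf.
have [lam [mu [y [yO E]]]] : in_span (b 0 * f).
  apply: in_ideal_min span_ideal _ _ bf => u; rewrite mem_cat => /orP[/mapP[s]|u_in].
    by rewrite mem_iota => s5 ->; apply: span_omit.
  exact/span_gs/in_ideal_gen.
have bb x : in_ideal (b 0 :: gs) (b 0 * x).
  by apply: in_idealMr; apply: in_ideal_gen; rewrite inE eqxx.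
have gsW x : in_ideal gs x -> in_ideal (b 0 :: gs) x := @in_ideal_consW _ _ _ x.
set sm := \sum_(_ <= _ < _) _ in E.
have sm_in : in_ideal (b 0 :: gs) (sm + mu%:MP * full b).
  have -> : sm + mu%:MP * full b =
    b 0 * (f - y) - (b 0 * f - (sm + mu%:MP * full b + b 0 * y)) by ring.
  by apply: in_idealB; [apply: bb | apply: gsW].
have b_omit i s : (1 <= i <= 5)%N -> (1 <= s <= 5)%N -> i != s -> in_ideal (b 0 :: gs) (b i * omit b s).
  move=> i5 s5 ne; have [s' _ E'] := reduce i5 s5 ne; exact: (in_idealBr (gsW _ E')).2 (bb _).
have lam0 t : (1 <= t <= 5)%N -> lam t = 0.
  move=> t5; apply: full_coef.
  have bfull : in_ideal (b 0 :: gs) (b t * full b).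
    have [s s5 ne] : exists2 s, (1 <= s <= 5)%N & t != s.
      by have [->|ne] := eqVneq t 1%N; [exists 2%N | exists 1%N].
    by rewrite -(mul_omit b s5) mulrCA; apply: in_idealMl; apply: b_omit.
  have := in_idealMl (b t) sm_in; rewrite mulrDr => /in_idealB /(_ (in_idealMl mu%:MP bfull)).
  rewrite [b t * (mu%:MP * _)]mulrCA addrK /sm mulr_sumr.
  rewrite (bigD1_seq t) ?mem_index_iota ?iota_uniq //= mulrCA mul_omit //.
  set rest := \sum_(_ <- _ | _) _; suff rest_in : in_ideal (b 0 :: gs) rest.
    by move/in_idealB/(_ rest_in); rewrite addrK.
  rewrite /rest big_seq_cond; apply: is_ideal_sum => [|s /andP[]]; first exact: in_ideal_is_ideal.
  rewrite mem_index_iota => s5 ne; rewrite mulrCA; apply: in_idealMl; apply: b_omit => //.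
  by rewrite eq_sym.
have sm0 : sm = 0.
  by rewrite /sm big_nat big1 // => s s5; rewrite lam0 ?mpolyC0 ?mul0r.
have mu0 : mu = 0 by apply: full_coef; move: sm_in; rewrite sm0 add0r.
have fy : in_ideal gs (f - y).
  by apply: b0_regular; move: E; rewrite sm0 mu0 mpolyC0 mul0r !add0r -mulrBr.
rewrite -(subrK y f); apply: in_idealD.
  by apply: in_ideal_subset fy => u; rewrite mem_cat orbC => ->.
by apply: in_ideal_subset yO => u; rewrite mem_cat => ->.
Qed.

Lemma omit_colon g f : in_ideal gs (g - (b 1 * b 5 - b 0 ^+ 2)) -> in_ideal gs (g * f) ->
  in_ideal (omits ++ gs) f.
Proof.
move=> gE gf.
have sub x : in_ideal gs x -> in_ideal (omits ++ gs) x.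
  by apply: in_ideal_subset => u; rewrite mem_cat orbC => ->.
have E : in_ideal gs ((b 1 * b 5 - b 0 ^+ 2) * f).
  have -> : (b 1 * b 5 - b 0 ^+ 2) * f = g * f - (g - (b 1 * b 5 - b 0 ^+ 2)) * f by ring.
  by apply: in_idealB => //; apply: in_idealMr.
suff : in_ideal (omits ++ gs) (b 0 ^+ 6 * f).
  (* The 6 comes from u^3 - v^3 with u = b_1 b_5 and v = b_0^2: as u f = v f, b_0^6 f equals u^3 f,
     a multiple of [omit b 3]. *)
  elim: 6%N => [|k IH]; first by rewrite mul1r.
  by rewrite exprS -mulrA => /omit_regular.
have cube := @cube_reduce S gs b r1 r5.
have -> : b 0 ^+ 6 * f = ((b 1 * b 5) ^+ 3 - b 0 ^+ 2 * omit b 3) * f + b 0 ^+ 2 * f * omit b 3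
  - ((b 1 * b 5) ^+ 2 + (b 1 * b 5) * b 0 ^+ 2 + b 0 ^+ 4) * ((b 1 * b 5 - b 0 ^+ 2) * f) by ring.
apply: in_idealB; last by apply: sub; apply: in_idealMl.
apply: in_idealD; first by apply: sub; apply: in_idealMr.
by apply: in_idealMl; apply: in_ideal_gen; rewrite mem_cat omits_mem.
Qed.

End OmitIdeal.

(** The colon ideal is known modulo all of [fs]; [colon_descent] lifts its description one form at a
    time, and [regular_colon] makes each form regular modulo g. *)
Lemma regular_seq_colon (K : fieldType) (m : nat) (gs ms fs : seq {mpoly K[m]}) g :
  homogeneous (ms ++ gs) -> (forall f, f \in fs -> f \is 1.-homog) ->
  regular_seq gs fs -> (forall u, u \in ms -> in_ideal gs (g * u)) ->
  (forall f, in_ideal (rev fs ++ gs) (g * f) -> in_ideal (ms ++ rev fs ++ gs) f) ->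
  regular_seq (g :: gs) fs /\ forall f, in_ideal gs (g * f) -> in_ideal (ms ++ gs) f.
Proof.
elim: fs gs => //= f fs IH gs hgs hfs [rf rfs] gms.
rewrite rev_cons cat_rcons => colon.
have hf : f \is 1.-homog by apply: hfs; rewrite inE eqxx.
have [||//||//|reg colon'] := IH (f :: gs).
- move=> u; rewrite mem_cat inE => /or3P[u_in|/eqP->|u_in]; last 2 first.
  + by exists 1%N.
  + by apply: hgs; rewrite mem_cat u_in orbT.
  by apply: hgs; rewrite mem_cat u_in.
- by move=> u u_in; apply: hfs; rewrite inE u_in orbT.
- by move=> u /gms; apply: in_ideal_consW.
split; last exact: colon_descent rf gms colon'.
split; first exact: regular_colon rf gms colon'.
by apply: eq_regular_seq reg; apply: same_ideal_mem => u; rewrite !inE orbCA.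
Qed.

(** * A regular sequence of length 6 for the hexagon *)

Section HexagonDepth.
Variable K : fieldType.
Notation S := {mpoly K[(3 + 3) + (3 + 3)]}.
Notation J := (BEI_gens K (Gk_edge 3)).

Let al (i : nat) : 'I_((3 + 3) + (3 + 3)) := lshift (3 + 3) (hex i).
Let be (i : nat) : 'I_((3 + 3) + (3 + 3)) := rshift (3 + 3) (hex i).
Let a (i : nat) : S := 'X_(al i).
Let b (i : nat) : S := 'X_(be i).
Let Q : seq S := path_minors K al be 0 5.
Let g : S := hex_minor K 0 5.
(** Modulo these forms a_t is b_(t+1), indices mod 6, and six variables remain. *)
Let zs : seq S := [seq a t - b t.+1 | t <- iota 0 5] ++ [:: a 5 - b 0].
Let I6 := rev zs ++ Q.
Let ms : seq S := [:: a 1 * a 2 * a 3 * a 4; b 1 * a 2 * a 3 * a 4; b 1 * b 2 * a 3 * a 4;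
  b 1 * b 2 * b 3 * a 4; b 1 * b 2 * b 3 * b 4].
Let omits : seq S := [seq omit b s | s <- iota 1 5].

Let homogX i : 'X_i \is [in K[(3 + 3) + (3 + 3)], 1.-homog].
Proof. by rewrite dhomogX /= mdeg1. Qed.

Let Q_homog : homogeneous Q.
Proof.
move=> q /mapP[t _ ->]; exists 2%N.
by rewrite rpredB // -[2%N]/(1 + 1)%N dhomogM // homogX.
Qed.

Let zs_homog f : f \in zs -> f \is [in K[(3 + 3) + (3 + 3)], 1.-homog].
Proof.
rewrite mem_cat mem_seq1 => /orP[/mapP[t _ ->]|/eqP->]; by rewrite rpredB // homogX.
Qed.

Let hex_inj i j : (i <= 5)%N -> (j <= 5)%N -> hex i = hex j -> i = j.
Proof.
move=> i5 j5 /(congr1 val) /=; rewrite /hex !inordK.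
- by move: i5 j5; case: i => [|[|[|[|[|[|]]]]]] // _; case: j => [|[|[|[|[|[|]]]]]].
- by move: j5; case: j => [|[|[|[|[|[|]]]]]].
by move: i5; case: i => [|[|[|[|[|[|]]]]]].
Qed.

(** The regular sequence of the path, with a_5 replaced by a_5 - b_0, the same element modulo b_0,
    and b_0 then rotated to the end. *)
Let zs_regular : regular_seq Q zs /\ regular I6 (b 0).
Proof.
have : regular_seq Q (b 0 :: path_params K al be 0 5).
  apply: path_ideal_regular_seq => [i j i5 j5|i j i5 j5|i j].
  - by move/lshift_inj; apply: hex_inj.
  - by move/rshift_inj; apply: hex_inj.
  by rewrite eq_lrshift.
rewrite /path_params cats1 -rcons_cons => /regular_seq_rcons[reg5 rega].
apply/regular_seq_rcons; apply: regular_seq_rot => //; first exact: homogX.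
rewrite /zs cats1 -rcons_cons; apply/regular_seq_rcons; split=> // f zf.
apply: rega; have -> : 'X_(al (0 + 5)) * f = (a 5 - b 0) * f + f * b 0 by rewrite /a; ring.
apply: in_idealD => //; apply: in_idealMl; apply: in_ideal_gen.
by rewrite mem_cat mem_rev inE eqxx.
Qed.

Let zI t : (t < 5)%N -> in_ideal I6 (a t - b t.+1).
Proof.
move=> t5; apply: in_ideal_gen; rewrite mem_cat mem_rev mem_cat.
by rewrite (map_f (fun t => a t - b t.+1)) // mem_iota.
Qed.

Let z5I : in_ideal I6 (a 5 - b 0).
Proof. by apply: in_ideal_gen; rewrite mem_cat mem_rev mem_cat mem_seq1 eqxx orbT. Qed.

Let qI t : (t < 5)%N -> in_ideal Q (a t * b t.+1 - a t.+1 * b t).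
Proof. by move=> t5; apply: in_ideal_gen; apply: (map_f (path_minor K al be)); rewrite mem_iota. Qed.

Let QI f : in_ideal Q f -> in_ideal I6 f.
Proof. by apply: in_ideal_subset => u; rewrite mem_cat orbC => ->. Qed.

Let rI t : (t < 4)%N -> in_ideal I6 (b t.+1 ^+ 2 - b t * b t.+2).
Proof.
move=> t4; have -> : b t.+1 ^+ 2 - b t * b t.+2 =
    (a t * b t.+1 - a t.+1 * b t) - b t.+1 * (a t - b t.+1) + b t * (a t.+1 - b t.+2) by ring.
apply: in_idealD; last by apply: in_idealMl; apply: zI.
by apply: in_idealB; [apply/QI/qI; lia | apply: in_idealMl; apply: zI; lia].
Qed.

Let r5I : in_ideal I6 (b 5 ^+ 2 - b 4 * b 0).
Proof.
have -> : b 5 ^+ 2 - b 4 * b 0 =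
    (a 4 * b 5 - a 5 * b 4) - b 5 * (a 4 - b 5) + b 4 * (a 5 - b 0) by ring.
apply: in_idealD; last by apply: in_idealMl.
by apply: in_idealB; [apply/QI/qI | apply: in_idealMl; apply: zI].
Qed.

Let g_reduce : in_ideal I6 (g - (b 1 * b 5 - b 0 ^+ 2)).
Proof.
have -> : g - (b 1 * b 5 - b 0 ^+ 2) = b 5 * (a 0 - b 1) - b 0 * (a 5 - b 0).
  by rewrite /g /hex_minor -!/(a _) -!/(b _) /a /b /al /be /var_a /var_b; ring.
by apply: in_idealB; apply: in_idealMl => //; apply: zI.
Qed.

(** A factor a_t b_(t+1) may be exchanged for a_(t+1) b_t modulo [Q]. Five exchanges, one for each
    edge, lead from a_0 b_5 u to a_5 b_0 u; the identities are the telescoping sums. *)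
Let gms u : u \in ms -> in_ideal Q (g * u).
Proof.
have gE : g = a 0 * b 5 - a 5 * b 0 by [].
pose q t : S := a t * b t.+1 - a t.+1 * b t.
have qQ t c : (t < 5)%N -> in_ideal Q (c * q t) by move=> t5; apply: in_idealMl; apply: qI.
rewrite !inE gE => /or4P[/eqP->|/eqP->|/eqP->|/orP[]/eqP->].
- have -> : (a 0 * b 5 - a 5 * b 0) * (a 1 * a 2 * a 3 * a 4) =
    a 0 * a 1 * a 2 * a 3 * q 4 + a 0 * a 1 * a 2 * a 5 * q 3 + a 0 * a 1 * a 4 * a 5 * q 2
    + a 0 * a 3 * a 4 * a 5 * q 1 + a 2 * a 3 * a 4 * a 5 * q 0 by rewrite /q; ring.
  by repeat (apply: in_idealD; last exact: qQ); apply: qQ.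
- have -> : (a 0 * b 5 - a 5 * b 0) * (b 1 * a 2 * a 3 * a 4) =
    a 2 * a 3 * a 4 * b 5 * q 0 + a 1 * a 2 * a 3 * b 0 * q 4 + a 1 * a 2 * a 5 * b 0 * q 3
    + a 1 * a 4 * a 5 * b 0 * q 2 + a 3 * a 4 * a 5 * b 0 * q 1 by rewrite /q; ring.
  by repeat (apply: in_idealD; last exact: qQ); apply: qQ.
- have -> : (a 0 * b 5 - a 5 * b 0) * (b 1 * b 2 * a 3 * a 4) =
    a 3 * a 4 * b 2 * b 5 * q 0 + a 3 * a 4 * b 0 * b 5 * q 1 + a 2 * a 3 * b 0 * b 1 * q 4
    + a 2 * a 5 * b 0 * b 1 * q 3 + a 4 * a 5 * b 0 * b 1 * q 2 by rewrite /q; ring.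
  by repeat (apply: in_idealD; last exact: qQ); apply: qQ.
- have -> : (a 0 * b 5 - a 5 * b 0) * (b 1 * b 2 * b 3 * a 4) =
    a 4 * b 2 * b 3 * b 5 * q 0 + a 4 * b 0 * b 3 * b 5 * q 1 + a 4 * b 0 * b 1 * b 5 * q 2
    + a 3 * b 0 * b 1 * b 2 * q 4 + a 5 * b 0 * b 1 * b 2 * q 3 by rewrite /q; ring.
  by repeat (apply: in_idealD; last exact: qQ); apply: qQ.
have -> : (a 0 * b 5 - a 5 * b 0) * (b 1 * b 2 * b 3 * b 4) =
    b 2 * b 3 * b 4 * b 5 * q 0 + b 0 * b 3 * b 4 * b 5 * q 1 + b 0 * b 1 * b 4 * b 5 * q 2
    + b 0 * b 1 * b 2 * b 5 * q 3 + b 0 * b 1 * b 2 * b 3 * q 4 by rewrite /q; ring.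
by repeat (apply: in_idealD; last exact: qQ); apply: qQ.
Qed.

(** Replacing a_t by b_(t+1) turns m_t into the product with index t + 1 omitted. *)
Let ms_omits : same_ideal (ms ++ I6) (omits ++ I6).
Proof.
have sub (hs hs' : seq S) : (forall f, f \in hs -> exists2 f', f' \in hs' & in_ideal I6 (f - f')) ->
    forall f, f \in hs ++ I6 -> in_ideal (hs' ++ I6) f.
  move=> hh f; rewrite mem_cat => /orP[/hh[f' f'_in]|f_in]; last first.
    by apply: in_ideal_gen; rewrite mem_cat f_in orbT.
  move=> ff'; rewrite -(subrK f' f); apply: in_idealD.
    by apply: in_ideal_subset ff' => u uI; rewrite (mem_cat u hs' I6) uI orbT.
  by apply: in_ideal_gen; rewrite mem_cat f'_in.
pose z t : S := a t - b t.+1.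
have zI' t c : (t < 5)%N -> in_ideal I6 (c * z t) by move=> t5; apply: in_idealMl; apply: zI.
have d1 : in_ideal I6 (a 1 * a 2 * a 3 * a 4 - omit b 1).
  have -> : a 1 * a 2 * a 3 * a 4 - omit b 1 = a 2 * a 3 * a 4 * z 1 + b 2 * a 3 * a 4 * z 2
    + b 2 * b 3 * a 4 * z 3 + b 2 * b 3 * b 4 * z 4 by rewrite /omit /z; ring.
  by repeat (apply: in_idealD; last exact: zI'); apply: zI'.
have d2 : in_ideal I6 (b 1 * a 2 * a 3 * a 4 - omit b 2).
  have -> : b 1 * a 2 * a 3 * a 4 - omit b 2 = b 1 * a 3 * a 4 * z 2
    + b 1 * b 3 * a 4 * z 3 + b 1 * b 3 * b 4 * z 4 by rewrite /omit /z; ring.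
  by repeat (apply: in_idealD; last exact: zI'); apply: zI'.
have d3 : in_ideal I6 (b 1 * b 2 * a 3 * a 4 - omit b 3).
  have -> : b 1 * b 2 * a 3 * a 4 - omit b 3 = b 1 * b 2 * a 4 * z 3 + b 1 * b 2 * b 4 * z 4.
    by rewrite /omit /z; ring.
  by apply: in_idealD; apply: zI'.
have d4 : in_ideal I6 (b 1 * b 2 * b 3 * a 4 - omit b 4).
  have -> : b 1 * b 2 * b 3 * a 4 - omit b 4 = b 1 * b 2 * b 3 * z 4 by rewrite /omit /z; ring.
  exact: zI'.
have d5 : in_ideal I6 (b 1 * b 2 * b 3 * b 4 - omit b 5) by rewrite subrr; apply: in_ideal0.
apply: same_ideal_gens; apply: sub => f; rewrite !inE.
  case/or4P=> [/eqP->|/eqP->|/eqP->|/orP[]/eqP->]; [exists (omit b 1)|exists (omit b 2)|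
    exists (omit b 3)|exists (omit b 4)|exists (omit b 5)] => //; by rewrite !inE eqxx ?orbT.
case/or4P=> [/eqP->|/eqP->|/eqP->|/orP[]/eqP->]; rewrite -?[omit b _]opprB.
- by exists (a 1 * a 2 * a 3 * a 4); rewrite ?inE ?eqxx // -opprB; apply: in_idealN.
- by exists (b 1 * a 2 * a 3 * a 4); rewrite ?inE ?eqxx ?orbT // -opprB; apply: in_idealN.
- by exists (b 1 * b 2 * a 3 * a 4); rewrite ?inE ?eqxx ?orbT // -opprB; apply: in_idealN.
- by exists (b 1 * b 2 * b 3 * a 4); rewrite ?inE ?eqxx ?orbT // -opprB; apply: in_idealN.
by exists (b 1 * b 2 * b 3 * b 4); rewrite ?inE ?eqxx ?orbT // -opprB; apply: in_idealN.
Qed.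

Let I6_vars i : exists2 j, (j <= 5)%N & in_ideal I6 ('X_i - b j).
Proof.
rewrite -(splitK i); case: (split i) => v; have [t t6 ->] := hexP v.
  (* a_5 wraps round to b_0. *)
  have [->|t5] := eqVneq t 5%N; first by exists 0%N.
  by exists t.+1; [|apply: zI]; lia.
by exists t => //; rewrite /= subrr; apply: in_ideal0.
Qed.

(** [rho] sends a_t to X_(t+1) and b_t to X_t, indices mod 6. It kills [zs] and carries the path
    minors to the binomials of [full_notin_reduced]. *)
Let full_notin : ~ in_ideal (b 0 :: I6) (full b).
Proof.
pose pos (v : 'I_(3 + 3)) := index (v : nat) [:: 0; 3; 1; 5; 2; 4]%N.
pose X i : {mpoly K[6]} := 'X_(inord i).
pose rho : {rmorphism S -> {mpoly K[6]}} :=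
  mmap (@mpolyC _ K) (split_vars (fun v => X ((pos v).+1 %% 6)%N) (fun v => X (pos v))).
have pos_hex t : (t < 6)%N -> pos (hex t) = t.
  by rewrite /pos /hex => t6; rewrite inordK; case: t t6 => [|[|[|[|[|[|]]]]]].
have rho_a t : (t < 6)%N -> rho (a t) = X (t.+1 %% 6)%N.
  move=> t6; rewrite /rho /= /a mmapX mmap1U /split_vars -[al t]/(unsplit (inl (hex t))) unsplitK.
  by rewrite pos_hex.
have rho_b t : (t < 6)%N -> rho (b t) = X t.
  move=> t6; rewrite /rho /= /b mmapX mmap1U /split_vars -[be t]/(unsplit (inr (hex t))) unsplitK.
  by rewrite pos_hex.
move=> full_in; apply: (@full_notin_reduced K).
have -> : full (fun i => 'X_(inord i)) = rho (full b) :> {mpoly K[6]}.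
  by rewrite /full !rmorphM /= !rho_b.
set L := [:: _; _; _; _; _; _].
apply: (in_ideal_min (I := fun f => in_ideal L (rho f))) full_in => [|f].
  split; first by rewrite rmorph0; apply: in_ideal0.
  split=> [f f' fL fL'|f f' fL]; rewrite ?rmorphD ?rmorphM; first exact: in_idealD.
  exact: in_idealMl.
rewrite in_cons => /orP[/eqP->|].
  by rewrite rho_b //; apply: in_ideal_gen; rewrite inE eqxx.
rewrite mem_cat mem_rev mem_cat => /orP[/orP[/mapP[t]|]|/mapP[t]].
- rewrite mem_iota => t5 ->; rewrite rmorphB /= rho_a ?rho_b; [|lia|lia].
  by rewrite modn_small ?subrr; [apply: in_ideal0|lia].
- by rewrite mem_seq1 => /eqP->; rewrite rmorphB /= rho_a ?rho_b // subrr; apply: in_ideal0.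
rewrite mem_iota /path_minor => t5 ->; rewrite rmorphB !rmorphM /=.
rewrite -!/(a _) -!/(b _) !rho_a ?rho_b; try lia.
have e1 : (t.+1 %% 6 = t.+1)%N by rewrite modn_small //; lia.
have e2 : (t.+2 %% 6 = nth 0 [:: 2; 3; 4; 5; 0] t)%N.
  by move: t5; case: t {e1} => [|[|[|[|[|]]]]].
apply: in_ideal_gen; rewrite e1 e2 -expr2 [X (nth _ _ _) * _]mulrC /L.
by move: t5; case: t {e1 e2} => [|[|[|[|[|]]]]] // _; rewrite /X /= !in_cons eqxx ?orbT.
Qed.

Let colon6 f : in_ideal (rev zs ++ Q) (g * f) -> in_ideal (ms ++ rev zs ++ Q) f.
Proof.
move=> gf; apply/ms_omits.
exact: (omit_colon (rI (t := 0) isT) (rI (t := 1) isT) (rI (t := 2) isT) (rI (t := 3) isT)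
  r5I I6_vars zs_regular.2 full_notin g_reduce gf).
Qed.

Let ms_homog : homogeneous (ms ++ Q).
Proof.
move=> u; rewrite mem_cat => /orP[u_in|]; last exact: Q_homog.
exists 4%N; have mul4 x y z t : x \is 1.-homog -> y \is 1.-homog -> z \is 1.-homog ->
    t \is 1.-homog -> x * y * z * t \is [in K[(3 + 3) + (3 + 3)], 4.-homog].
  by move=> hx hy hz ht; rewrite -[4%N]/(1 + 1 + 1 + 1)%N !dhomogM.
by move: u_in; rewrite !inE => /or4P[/eqP->|/eqP->|/eqP->|/orP[]/eqP->];
  apply: mul4; apply: homogX.
Qed.

Lemma hex_depth_lower : depth_ge (all_vars K (3 + 3)) J 6.
Proof.
have [reg _] := regular_seq_colon ms_homog zs_homog zs_regular.1 gms colon6.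
exists zs; split; first by rewrite size_cat size_map size_iota.
have a_in t : in_ideal (all_vars K (3 + 3)) (a t).
  change (in_ideal (all_vars K (3 + 3)) (var_a K (hex t))); apply: in_ideal_gen.
  by rewrite mem_cat map_f // mem_enum.
have b_in t : in_ideal (all_vars K (3 + 3)) (b t).
  change (in_ideal (all_vars K (3 + 3)) (var_b K (hex t))); apply: in_ideal_gen.
  by rewrite mem_cat orbC map_f // mem_enum.
split.
  by move=> f; rewrite mem_cat mem_seq1 => /orP[/mapP[t _ ->]|/eqP->]; apply: in_idealB.
split.
  by apply/regular_seq_takeP; apply: eq_regular_seq reg; apply/same_ideal_sym/BEI_hexE.
move=> one_in; suff : meval (fun=> 0) (1 : S) = 0 by rewrite meval1 => /eqP; rewrite oner_eq0.
have X0 i : meval (fun=> 0) ('X_i : S) = 0 by rewrite mevalXU.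
apply: (in_ideal_min (I := fun f : S => meval (fun=> 0) f = 0)) one_in => [|f].
  split; first exact: meval0.
  split=> [x y|x y]; first by rewrite mevalD => -> ->; rewrite addr0.
  by rewrite mevalM => ->; rewrite mulr0.
rewrite mem_cat => /orP[/mapP[p _ ->]|].
  by rewrite mevalB !mevalM !X0 !mul0r subr0.
by rewrite mem_cat mem_seq1 => /orP[/mapP[t _ ->]|/eqP->]; rewrite mevalB !X0 subr0.
Qed.

End HexagonDepth.

(** Turns bounds on a monotone invariant into an exact value, by excluded middle. *)
Lemma ex_threshold (P : nat -> Prop) l u : P l -> ~ P u.+1 -> (forall i j, (i <= j)%N -> P j -> P i) ->
  exists2 d, (l <= d <= u)%N & P d /\ ~ P d.+1.
Proof.
move=> Pl nPu mono; have lu : (l <= u)%N.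
  by rewrite leqNgt; apply/negP => /mono /(_ Pl).
elim: u lu nPu => [|u IH] lu nPu.
  by exists 0%N => //; move: lu Pl; rewrite leqn0 => /eqP->.
have [Pu|nPu'] := classic (P u.+1); first by exists u.+1 => //; rewrite lu leqnn.
have [lu'|ul] := leqP l u.
  by have [d /andP[ld du] Pd] := IH lu' nPu'; exists d => //; rewrite ld leqW.
by case: nPu'; apply: mono Pl.
Qed.

(** * Remaining bounds and assembly *)

Lemma hex_krull_dim_lower (K : fieldType) : krull_dim_ge (BEI_gens K (Gk_edge 3)) 7.
Proof.
(* The whole hexagon as one component: one parameter b and six parameters a. *)
have := @krull_dim_lower K _ (Gk_edge 3) (enum 'I_(3 + 3)) [:: ord0] (fun=> ord0).
rewrite size_enum_ord; apply=> //; first exact: enum_uniq.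
  by move=> i; rewrite mem_enum.
by move=> i; rewrite inE => /eqP.
Qed.

Lemma BEI_proper (K : fieldType) (n : nat) (E : rel 'I_n) : ~ in_ideal (BEI_gens K E) 1.
Proof.
move=> one_in; pose ev (f : {mpoly K[n + n]}) := meval (fun=> 0) f.
suff : ev 1 = 0 by rewrite /ev meval1 => /eqP; rewrite oner_eq0.
apply: (in_ideal_min (I := fun f => ev f = 0)) one_in => [|f /mapP[p _ ->]].
  split; first exact: meval0.
  split=> [x y|x y]; rewrite /ev; first by rewrite mevalD => -> ->; rewrite addr0.
  by rewrite mevalM => ->; rewrite mulr0.
by rewrite /ev mevalB !mevalM !mevalXU !mul0r subr0.
Qed.

Local Close Scope ring_scope.

Theorem theorem4p6 (K : fieldType) (k : nat) (hk : (3 <= k)%N) :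
  ~ BEI_CM K (Gk_edge k) /\
  exists dm dp : nat,
    krull_dim_quot (BEI_gens K (Gk_edge k)) dm /\
    depth_quot (all_vars K (k + k)) (BEI_gens K (Gk_edge k)) dp /\
    (k = 3 -> (dm - dp = 1)%N) /\
    ((4 <= k)%N -> (k - 3 <= dm - dp)%N).
Proof.
set J := BEI_gens K (Gk_edge k); set M := all_vars K (k + k).
have [l [u [l' [dim_l dim_u depth_l l_gt lk]]]] : exists l u l',
    [/\ krull_dim_ge J l, ~ krull_dim_ge J u.+1, depth_ge M J l', (k + k < l)%N &
        (k = 3 -> [/\ l = 7, u = 7 & l' = 6]) /\ ((4 <= k)%N -> (3 * k.-1 <= l)%N)].
  (* For k >= 4 the number 4k of variables bounds the dimension above and 0 bounds the depth below;
     for k = 3 the bounds are sharp. *)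
  have [k4|k3] := leqP 4 k.
    exists (3 * k.-1)%N, ((k + k) + (k + k))%N, 0%N; split.
    - exact: Gk_krull_dim_lower.
    - exact: krull_dim_upper_vars.
    - exists [::]; split=> //; split=> //; split=> //; rewrite cats0.
      exact: BEI_proper.
    - by move: k4; clear; lia.
    by split=> // k3; rewrite k3 in k4.
  have {hk k3} k3 : k = 3 by move: hk k3; clear; lia.
  move: @J @M; rewrite k3 => J M; exists 7%N, 7%N, 6%N; split=> //.
  - exact: hex_krull_dim_lower.
  - exact: hex_krull_dim_upper.
  exact: hex_depth_lower.
have depth_u := @Gk_depth_upper K k hk.
have [dm /andP[ldm dmu] [dm1 dm2]] := ex_threshold dim_l dim_u (fun i j => @krull_dim_geW _ _ J j i).
have [dp /andP[ldp dpu] [dp1 dp2]] := ex_threshold depth_l depth_u (fun i j => @depth_geW _ _ M J j i).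
split.
  (* A common value d of dimension and depth would satisfy d <= 2k < l <= d. *)
  move=> [d [[d1 d2] [d3 d4]]]; apply: depth_u; apply: depth_geW d3.
  rewrite ltnNge; apply/negP => dk; apply: d2; apply: krull_dim_geW dim_l.
  exact: leq_ltn_trans dk l_gt.
exists dm, dp; do 3![split=> //].
  (* Here the dimension is 7 and the depth lies between 6 and 2k = 6. *)
  move=> k3; have [l7 u7 l6] := lk.1 k3; rewrite {}l7 {}u7 {}l6 k3 in ldm dmu ldp dpu.
  by move: ldm dmu ldp dpu; clear; lia.
(* 3 (k - 1) - 2k = k - 3. *)
by move=> k4; have := lk.2 k4; move: ldm dpu k4; clear; lia.
Qed.
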